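(* Let $\mathbb{F}\in\{\mathbb{R},\mathbb{C}\}$, let $p+q=n=2$, and let $V$ be a Euclidean space of dimension $r\ge 1$ with Cartesian coordinates $x^1,\dots,x^r$ and $\partial_\mu=\partial/\partial x^\mu$. Let $h^a:V\to\mathcal{C}\ell^{\mathbb{F}}_1(p,q)$, $a=1,2$, be smooth functions with values in the subspace of grade $1$ satisfying $$h^a(x)h^b(x)+h^b(x)h^a(x)=2\eta^{ab}e,\qquad a,b=1,2,\quad\forall x\in V.$$ Then there exists a function $C(x):V\to\mathcal{C}\ell^{\mathbb{F}}_2(p,q)$ such that $$dC(x)=C_1(x)dx^1+\cdots+C_r(x)dx^r,\qquad C_\mu(x)=\frac14\sum_{a=1}^{2}(\partial_\mu h^a)h_a,\qquad h_a:=(h^a)^{-1}.$$ Moreover, for some invertible element $K\in\mathcal{C}\ell^{\mathbb{F}}(p,q)$ (not depending on $x$), the function $$T(x)=\exp(C(x))K$$ satisfies $$e^a=T^{-1}(x)h^a(x)T(x),\qquad a=1,2,\quad\forall x\in V.$$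
   Context: $\mathcal{C}\ell^{\mathbb{R}}(p,q)$ with $p+q=2$ is the real Clifford algebra with identity $e$ and generators $e^1,e^2$ (independent of $x$) satisfying $e^ae^b+e^be^a=2\eta^{ab}e$, where $\eta=\|\eta^{ab}\|$ is the diagonal $2\times 2$ matrix with $p$ entries $1$ followed by $q$ entries $-1$; it has basis $e,e^1,e^2,e^{12}:=e^1e^2$. $\mathcal{C}\ell^{\mathbb{C}}(p,q)=\mathbb{C}\otimes\mathcal{C}\ell^{\mathbb{R}}(p,q)$. $\mathcal{C}\ell^{\mathbb{F}}_1(p,q)$ is the $\mathbb{F}$-span of $e^1,e^2$, and $\mathcal{C}\ell^{\mathbb{F}}_2(p,q)$ is the $\mathbb{F}$-span of $e^{12}$. $\exp(U)=\sum_{k\ge0}U^k/k!$. Functions into the algebra are smooth if their coordinates in the fixed basis are smooth. *)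

(* Defs.v *)
From HB Require Import structures.
From mathcomp Require Import all_boot all_order all_algebra all_field.
From mathcomp Require Import complex.
From mathcomp Require Import all_classical all_reals all_analysis.
From mathcomp Require Import ring.

Set Implicit Arguments.
Unset Strict Implicit.
Unset Printing Implicit Defensive.

Import Order.TTheory GRing.Theory Num.Theory.
Import numFieldNormedType.Exports.

Local Open Scope classical_set_scope.
Local Open Scope ring_scope.

(* Meaningful when p + q = 2, which is why q does not occur in the body. *)
Definition eta (F : pzRingType) (p q : nat) : 'M[F]_2 :=
  diag_mx (\row_(a < 2) (if (a < p)%N then 1 else -1)).

(* The Clifford algebra over F with p + q = 2 generators, in the coordinates
   (x_0, x_1, x_2, x_3) of x_0 e + x_1 e^1 + x_2 e^2 + x_3 e^1 e^2. Since the
   structure constants lie in {-1, 0, 1}, the algebra over the complex numbers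
   is the complexification of the real one. *)
Definition Cl (F : Type) (p q : nat) : Type := 'rV[F]_4.

Section CliffordAlgebra.
Variables (F : fieldType) (p q : nat).

HB.instance Definition _ := GRing.Lmodule.copy (Cl F p q) 'rV[F]_4.
HB.instance Definition _ := Vector.copy (Cl F p q) 'rV[F]_4.

Implicit Types U W Z : Cl F p q.

Definition cl_mk (a b c d : F) : Cl F p q := \row_(i < 4) [:: a; b; c; d]`_i.

Definition cl_one : Cl F p q := cl_mk 1 0 0 0.

Definition cl_mul U W : Cl F p q :=
  let s := eta F p q 0 0 in
  let t := eta F p q 1 1 in
  cl_mk (U 0 0 * W 0 0 + s * U 0 1 * W 0 1 + t * U 0 2 * W 0 2
           - s * t * U 0 3 * W 0 3)
        (U 0 0 * W 0 1 + U 0 1 * W 0 0 - t * U 0 2 * W 0 3 + t * U 0 3 * W 0 2)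
        (U 0 0 * W 0 2 + U 0 2 * W 0 0 + s * U 0 1 * W 0 3 - s * U 0 3 * W 0 1)
        (U 0 0 * W 0 3 + U 0 3 * W 0 0 + U 0 1 * W 0 2 - U 0 2 * W 0 1).

Lemma cl_mkE a b c d :
  [/\ cl_mk a b c d 0 0 = a, cl_mk a b c d 0 1 = b,
      cl_mk a b c d 0 2 = c & cl_mk a b c d 0 3 = d].
Proof. by split; rewrite mxE. Qed.

Lemma cl_ext U W :
  U 0 0 = W 0 0 -> U 0 1 = W 0 1 -> U 0 2 = W 0 2 -> U 0 3 = W 0 3 -> U = W.
Proof.
move=> E0 E1 E2 E3; apply/rowP => -[[|[|[|[|//]]]] Hi].
- by rewrite (_ : Ordinal Hi = 0) //; apply: val_inj.
- by rewrite (_ : Ordinal Hi = 1) //; apply: val_inj.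
- by rewrite (_ : Ordinal Hi = 2) //; apply: val_inj.
- by rewrite (_ : Ordinal Hi = 3) //; apply: val_inj.
Qed.

Lemma cl_addE U W i : (U + W) 0 i = U 0 i + W 0 i.
Proof. by rewrite mxE. Qed.

Lemma cl_scaleE (a : F) U i : (a *: U) 0 i = a * U 0 i.
Proof. by rewrite mxE. Qed.

Let mkE0 a b c d : cl_mk a b c d 0 0 = a. Proof. by case: (cl_mkE a b c d). Qed.
Let mkE1 a b c d : cl_mk a b c d 0 1 = b. Proof. by case: (cl_mkE a b c d). Qed.
Let mkE2 a b c d : cl_mk a b c d 0 2 = c. Proof. by case: (cl_mkE a b c d). Qed.
Let mkE3 a b c d : cl_mk a b c d 0 3 = d. Proof. by case: (cl_mkE a b c d). Qed.
Let clE := (mkE0, mkE1, mkE2, mkE3, cl_addE, cl_scaleE).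

Fact cl_mulA : associative cl_mul.
Proof. by move=> U W Z; apply: cl_ext; rewrite !clE; ring. Qed.

Fact cl_mul1l : left_id cl_one cl_mul.
Proof. by move=> U; apply: cl_ext; rewrite !clE; ring. Qed.

Fact cl_mul1r : right_id cl_one cl_mul.
Proof. by move=> U; apply: cl_ext; rewrite !clE; ring. Qed.

Fact cl_mulDl : left_distributive cl_mul +%R.
Proof. by move=> U W Z; apply: cl_ext; rewrite !clE; ring. Qed.

Fact cl_mulDr : right_distributive cl_mul +%R.
Proof. by move=> U W Z; apply: cl_ext; rewrite !clE; ring. Qed.

Fact cl_one_neq0 : cl_one != 0.
Proof.
apply/eqP => /(congr1 (fun U : Cl F p q => U 0 0)); rewrite !clE mxE => /eqP.
by rewrite oner_eq0.
Qed.

HB.instance Definition _ := GRing.Zmodule_isNzRing.Build (Cl F p q)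
  cl_mulA cl_mul1l cl_mul1r cl_mulDl cl_mulDr cl_one_neq0.

Fact cl_scaleAl (a : F) U W : a *: (U * W) = a *: U * W.
Proof. by apply: cl_ext; rewrite !clE; ring. Qed.

HB.instance Definition _ :=
  GRing.Lmodule_isLalgebra.Build F (Cl F p q) cl_scaleAl.

Fact cl_scaleAr (a : F) U W : a *: (U * W) = U * (a *: W).
Proof. by apply: cl_ext; rewrite !clE; ring. Qed.

HB.instance Definition _ :=
  GRing.Lalgebra_isAlgebra.Build F (Cl F p q) cl_scaleAr.
HB.instance Definition _ := Algebra_isFalgebra.Build F (Cl F p q).

(* Indices are shifted by one: cl_gen 0 is e^1 and cl_gen 1 is e^2. *)
Definition cl_gen (a : 'I_2) : Cl F p q :=
  if a == 0 then cl_mk 0 1 0 0 else cl_mk 0 0 1 0.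

Definition cl_e12 : Cl F p q := cl_gen 0 * cl_gen 1.

Definition cl_grade1 : {vspace Cl F p q} := <<[:: cl_gen 0%R; cl_gen 1%R]>>%VS.

Definition cl_grade2 : {vspace Cl F p q} := <[cl_e12]>%VS.

Lemma cl_gen_anticomm (a b : 'I_2) :
  cl_gen a * cl_gen b + cl_gen b * cl_gen a = (2 * eta F p q a b) *: 1.
Proof.
have I2 (i : 'I_2) : i = 0 \/ i = 1.
  by case: i => -[|[|//]] Hi; [left|right]; apply: val_inj.
have e01 : eta F p q 0 1 = 0 by rewrite !mxE.
have e10 : eta F p q 1 0 = 0 by rewrite !mxE.
by case: (I2 a) => ->; case: (I2 b) => ->; rewrite /cl_gen /= ?e01 ?e10;
  apply: cl_ext; rewrite !clE; ring.
Qed.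

Lemma cl_coordE U :
  U = U 0 0 *: 1 + U 0 1 *: cl_gen 0 + U 0 2 *: cl_gen 1 + U 0 3 *: cl_e12.
Proof. by apply: cl_ext; rewrite /cl_e12 /cl_gen /= !clE; ring. Qed.

Lemma cl_basis : basis_of fullv [:: 1; cl_gen 0; cl_gen 1; cl_e12].
Proof.
rewrite basisEdim; apply/andP; split; last by rewrite dimvf.
apply/subvP => U _; rewrite [U]cl_coordE.
by rewrite !memvD // memvZ // memv_span // !inE eqxx ?orbT.
Qed.

End CliffordAlgebra.

Section Exponential.
Variables (F : numFieldType) (p q : nat).

HB.instance Definition _ := NormedModule.copy (Cl F p q) 'rV[F]_4.

Definition cl_exp (U : Cl F p q) : Cl F p q :=
  lim (series (fun k : nat => (k`!%:R)^-1 *: U ^+ k) @ \oo).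

End Exponential.

Inductive base_field := Reals | Complexes.

Definition scalars (R : realType) (k : base_field) : numFieldType :=
  match k with Reals => R | Complexes => R[i] end.

Definition sc_re (R : realType) (k : base_field) : scalars R k -> R :=
  match k return scalars R k -> R with
  | Reals => id
  | Complexes => @complex.Re R
  end.

Definition sc_im (R : realType) (k : base_field) : scalars R k -> R :=
  match k return scalars R k -> R with
  | Reals => fun=> 0
  | Complexes => @complex.Im R
  end.

(* The scalar with real part a and imaginary part b; over the reals, b is
   ignored, and it is 0 whenever it comes from sc_im. *)
Definition sc_mk (R : realType) (k : base_field) (a b : R) : scalars R k :=
  match k return scalars R k with
  | Reals => a
  | Complexes => (a +i* b)%C
  end.

Section Calculus.
Variables (R : realType) (r : nat).
Local Notation V := 'rV[R]_r.

Definition axis (mu : 'I_r) : V := delta_mx 0 mu.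

Fixpoint Ck (m : nat) (f : V -> R) : Prop :=
  if m is m'.+1 then
    [/\ continuous f,
        forall mu x, derivable f x (axis mu)
      & forall mu, Ck m' (fun x => 'D_(axis mu) f x)]
  else continuous f.

Definition smooth (f : V -> R) : Prop := forall m, Ck m f.

Variables (k : base_field) (p q : nat).
Local Notation A := (Cl (scalars R k) p q).
Implicit Types f : V -> A.

(* Real and imaginary part of the i-th coordinate in the basis
   e, e^1, e^2, e^1 e^2. *)
Definition cl_re f (i : 'I_4) (x : V) : R := sc_re (f x 0 i).
Definition cl_im f (i : 'I_4) (x : V) : R := sc_im (f x 0 i).

Definition cl_smooth f : Prop :=
  forall i, smooth (cl_re f i) /\ smooth (cl_im f i).

Definition cl_partial (mu : 'I_r) f (x : V) : A :=
  \row_(i < 4) sc_mk k ('D_(axis mu) (cl_re f i) x)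
                       ('D_(axis mu) (cl_im f i) x).

(* The real-linear map df is the differential of f at x. *)
Definition cl_is_diff (x : V) f (df : V -> A) : Prop :=
  forall i, is_diff x (cl_re f i) (cl_re df i)
         /\ is_diff x (cl_im f i) (cl_im df i).

End Calculus.

(* Main.v *)
(** The coordinate matrix of a frame preserves eta, so with w = e^12 one has
    h^1 = g e^1 and h^2 = eps g e^2, where g = a + b w has norm 1 and eps = 1 or
    -1 is constant, being differentiable with square 1. Then
    C_mu = (1/2) (d_mu g) g^-1, which is a multiple of w. Choose a complex
    number l with l^2 = w^2; the characters w |-> l and w |-> -l separate the
    even subalgebra, and the first one maps g to a nowhere vanishing u : V -> C.
    On a ball, a logarithm of u / u(0) is the sum, over a subdivision of the ray
    from 0 to x, of the principal logarithms of the ratios of consecutive values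
    of u; these local functions agree because they have the same differential
    and vanish at 0. If L is the resulting logarithm, C = L / (2 l) w has
    differential C_mu dx^mu and exp(C)^2 g(0) = g(x). Hence conjugation by
    exp(C) turns h(0) into h(x), and K only has to carry the standard frame to
    h(0). *)
From HB Require Import structures.
Require Import Defs.
From mathcomp Require Import all_boot all_order all_algebra all_field.
From mathcomp Require Import complex.
From mathcomp Require Import all_classical all_reals all_analysis.
From mathcomp Require Import ring lra.

Set Implicit Arguments.
Unset Strict Implicit.
Unset Printing Implicit Defensive.

Import Order.TTheory GRing.Theory Num.Theory.
Import numFieldNormedType.Exports.

Local Open Scope classical_set_scope.
Local Open Scope ring_scope.

Local Notation ReC := complex.Re.
Local Notation ImC := complex.Im.

(** * Differentials of real-valued functions *)

Lemma is_diff_ext (R : realType) (V : normedModType R) (x : V)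
    (f df g dg : V -> R) :
  is_diff x f df -> f =1 g -> df =1 dg -> is_diff x g dg.
Proof. by move=> + /funext <- /funext <-. Qed.

Lemma is_diff_mul (R : realType) (V : normedModType R) (x : V)
    (f df g dg : V -> R) :
  is_diff x f df -> is_diff x g dg ->
  is_diff x (fun y => f y * g y) (fun v => f x * dg v + df v * g x).
Proof.
move=> df' dg'; apply: (is_diff_ext (is_diffM df' dg')) => // v.
by rewrite [df v * _]mulrC.
Qed.

(** * Differentials of complex-valued functions *)

Section ComplexValued.
Variables (R : realType) (V : normedModType R).
Implicit Types (x : V) (f g df dg : V -> R[i]).

(** Differentiability over the reals, kept as two real statements so that the real calculus rules
    apply to each part. *)
Definition cdiff x f df : Prop :=
  is_diff x (fun y => ReC (f y)) (fun v => ReC (df v)) /\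
  is_diff x (fun y => ImC (f y)) (fun v => ImC (df v)).

Lemma ReCD (z w : R[i]) : ReC (z + w) = ReC z + ReC w.
Proof. by case: z w => ? ? []. Qed.
Lemma ImCD (z w : R[i]) : ImC (z + w) = ImC z + ImC w.
Proof. by case: z w => ? ? []. Qed.
Lemma ReCM (z w : R[i]) : ReC (z * w) = ReC z * ReC w - ImC z * ImC w.
Proof. by case: z w => ? ? []. Qed.
Lemma ImCM (z w : R[i]) : ImC (z * w) = ReC z * ImC w + ImC z * ReC w.
Proof. by case: z w => ? ? []. Qed.
Lemma ReCN (z : R[i]) : ReC (- z) = - ReC z. Proof. by case: z. Qed.
Lemma ImCN (z : R[i]) : ImC (- z) = - ImC z. Proof. by case: z. Qed.
Lemma complex_ext (z w : R[i]) : ReC z = ReC w -> ImC z = ImC w -> z = w.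
Proof. by case: z w => ? ? [? ?] /= -> ->. Qed.

Lemma cdiff_ext x f g df dg :
  cdiff x f df -> f =1 g -> df =1 dg -> cdiff x g dg.
Proof. by move=> + /funext <- /funext <-. Qed.

Lemma cdiff_unique x f df dg : cdiff x f df -> cdiff x f dg -> df =1 dg.
Proof.
move=> [[_ r1] [_ i1]] [[_ r2] [_ i2]] v; apply: complex_ext.
  by have := congr1 (@^~ v) (etrans (esym r1) r2).
by have := congr1 (@^~ v) (etrans (esym i1) i2).
Qed.

Lemma cdiff_cst x (c : R[i]) : cdiff x (fun=> c) (fun=> 0).
Proof. by split; apply: is_diff_cst. Qed.

Lemma cdiffD x f g df dg : cdiff x f df -> cdiff x g dg ->
  cdiff x (fun y => f y + g y) (fun v => df v + dg v).
Proof.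
move=> [f1 f2] [g1 g2]; split.
- by apply: (is_diff_ext (is_diffD f1 g1)) => y; rewrite ReCD.
- by apply: (is_diff_ext (is_diffD f2 g2)) => y; rewrite ImCD.
Qed.

Lemma cdiffM x f g df dg : cdiff x f df -> cdiff x g dg ->
  cdiff x (fun y => f y * g y) (fun v => f x * dg v + df v * g x).
Proof.
move=> [f1 f2] [g1 g2]; split.
- apply: (is_diff_ext (is_diffB (is_diff_mul f1 g1) (is_diff_mul f2 g2))) => y.
    by rewrite ReCM.
  by rewrite ReCD !ReCM !fctE /=; lra.
- apply: (is_diff_ext (is_diffD (is_diff_mul f1 g2) (is_diff_mul f2 g1))) => y.
    by rewrite ImCM.
  by rewrite ImCD !ImCM !fctE /=; lra.
Qed.

Lemma cdiffMl x f df (c : R[i]) : cdiff x f df ->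
  cdiff x (fun y => c * f y) (fun v => c * df v).
Proof.
move=> /(cdiffM (cdiff_cst x c)) /cdiff_ext; apply=> // v.
by rewrite mul0r addr0.
Qed.

Lemma cdiffN x f df : cdiff x f df ->
  cdiff x (fun y => - f y) (fun v => - df v).
Proof. by move=> /(cdiffMl (-1)) /cdiff_ext; apply => y; rewrite mulN1r. Qed.

Lemma cdiffB x f g df dg : cdiff x f df -> cdiff x g dg ->
  cdiff x (fun y => f y - g y) (fun v => df v - dg v).
Proof. by move=> ? ?; apply: cdiffD => //; apply: cdiffN. Qed.

Lemma cdiff_sum x n (f df : 'I_n -> V -> R[i]) :
  (forall k, cdiff x (f k) (df k)) ->
  cdiff x (fun y => \sum_(k < n) f k y) (fun v => \sum_(k < n) df k v).
Proof.
elim: n f df => [|n IH] f df H.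
  by apply: (cdiff_ext (cdiff_cst x 0)) => y; rewrite big_ord0.
have := cdiffD (IH _ _ (fun k => H (widen_ord (leqnSn n) k))) (H ord_max).
by move/cdiff_ext; apply => y; rewrite big_ord_recr.
Qed.

Lemma is_diff_comp_real (h : R -> R) (h' : R) (f df : V -> R) x :
  is_derive (f x) 1 h h' -> is_diff x f df ->
  is_diff x (fun y => h (f y)) (fun v => df v * h').
Proof.
move=> hh ff.
have h1 : is_diff (f x) h (fun t => t *: h').
  have d : derivable h (f x) 1 by [].
  split; first exact/derivable1_diffP.
  rewrite deriv1E // derive1E derive_val //.
exact: (is_diff_comp ff h1).
Qed.

Lemma cdiff_real_comp (h : R -> R) (h' : R) (f df : V -> R) x :
  is_derive (f x) 1 h h' -> is_diff x f df ->
  cdiff x (fun y => (h (f y))%:C)%C (fun v => (df v * h')%:C)%C.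
Proof. by move=> hh ff; split; [exact: is_diff_comp_real | exact:
  is_diff_cst]. Qed.

Lemma cdiff_conj x f df : cdiff x f df ->
  cdiff x (fun y => conjc (f y)) (fun v => conjc (df v)).
Proof.
move=> [f1 f2]; split.
  by apply: (is_diff_ext f1) => y; rewrite /conjc; [case: (f y) | case: (df y)].
apply: (is_diff_ext (is_diffN f2)) => y; rewrite !fctE /=.
  by case: (f y).
by case: (df y).
Qed.

(** Writing 1/z as the conjugate of z times the real number 1/|z|^2 reduces the inverse to
    conjugation, a product and the real inverse. *)
Lemma cdiffV x f df : cdiff x f df -> f x != 0 ->
  cdiff x (fun y => (f y)^-1) (fun v => - (df v / f x ^+ 2)).
Proof.
move=> cf fx0; have cfc := cdiff_conj cf.
have [d1 _] := cdiffM cf cfc.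
have nC (z : R[i]) : z * conjc z = (ReC (z * conjc z))%:C%C.
  by case: z => a b; apply: complex_ext => //=; ring.
have fc0 : conjc (f x) != 0 by rewrite conjc_eq0.
have n0 : ReC (f x * conjc (f x)) != 0.
  have: f x * conjc (f x) != 0 by rewrite mulf_neq0.
  by apply: contra => /eqP e; rewrite nC e.
have dV : is_derive (ReC (f x * conjc (f x))) 1 (fun t : R => t^-1)
     (- (ReC (f x * conjc (f x)) ^- 2)).
  have := is_deriveV n0 (is_derive_id (ReC (f x * conjc (f x))) (1 : R)).
  by rewrite scaler1.
have := cdiffM cfc (cdiff_real_comp dV d1).
move/cdiff_ext; apply => [y|v].
  (* The formula must hold at every [y]; at a zero of [f] both sides are 0, because the inverse of 0
     is 0. *)
  rewrite fmorphV /= -nC; have [->|y0] := eqVneq (f y) 0.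
    by rewrite !mul0r invr0 mulr0.
  by rewrite invfM mulrCA mulfV ?mulr1 ?conjc_eq0.
set z := f x; set dz := df v.
rewrite -/z in fx0 fc0 n0.
have e1 : (ReC (z * conjc dz + dz * conjc z))%:C%C = z * conjc dz + dz * conjc
  z.
  by case: (z) (dz) => a b [c d]; apply: complex_ext => //=; ring.
rewrite rmorphM rmorphN !fmorphV rmorphXn /= e1 -nC; field.
by rewrite fx0 fc0.
Qed.

End ComplexValued.

(** * The complex exponential *)

Section Exp.
Variable R : realType.
Implicit Types z w : R[i].

(** Defined by real and imaginary parts; [ccvg_cexp_sum] identifies it with the sum of the power
    series. *)
Definition cexp z : R[i] :=
  ((expR (ReC z) * cos (ImC z)) +i* (expR (ReC z) * sin (ImC z)))%C.

Lemma cexpD z w : cexp (z + w) = cexp z * cexp w.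
Proof.
apply: complex_ext; rewrite /= ReCD ImCD expRD ?cosD ?sinD; ring.
Qed.

Lemma cexp0 : cexp 0 = 1.
Proof. by apply: complex_ext; rewrite /= expR0 ?cos0 ?sin0 ?mulr1 ?mulr0. Qed.

Lemma cexpN z : cexp z * cexp (- z) = 1.
Proof. by rewrite -cexpD subrr cexp0. Qed.

Lemma cdiff_cexp (V : normedModType R) (x : V) (f df : V -> R[i]) :
  cdiff x f df -> cdiff x (fun y => cexp (f y)) (fun v => df v * cexp (f x)).
Proof.
move=> [f1 f2].
have E := is_diff_comp_real (is_derive_expR (ReC (f x))) f1.
have C := is_diff_comp_real (is_derive_cos (ImC (f x))) f2.
have S := is_diff_comp_real (is_derive_sin (ImC (f x))) f2.
split.
  apply: (is_diff_ext (is_diff_mul E C)) => // v.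
  by rewrite ReCM /=; ring.
apply: (is_diff_ext (is_diff_mul E S)) => // v.
by rewrite ImCM /=; ring.
Qed.

Lemma is_diff_is_derive (f : R -> R) (x d : R) :
  is_diff x f (fun v => v * d) -> is_derive x 1 f d.
Proof.
move=> [df e]; split; first exact: diff_derivable.
by rewrite deriveE // e mul1r.
Qed.

(** The mean value theorem for differentials given as multiplication by a number; later uses
    reparametrize a segment to [0, 1]. *)
Lemma is_diff_MVT (f d : R -> R) :
  (forall t : R, 0 <= t <= 1 -> is_diff t f (fun v => v * d t)) ->
  exists2 t, 0 <= t <= 1 & f 1 - f 0 = d t.
Proof.
move=> H.
have [t| |t] := @MVT_segment R f d 0 1 ler01.
- rewrite in_itv /= => /andP[t0 t1]; apply: is_diff_is_derive.
  by apply: H; rewrite !ltW.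
- apply: continuous_in_subspaceT => t; rewrite inE /= in_itv /= => /H [? _].
  exact: differentiable_continuous.
by rewrite in_itv subr0 mulr1; exists t.
Qed.

Lemma cdiffX (V : normedModType R) (x : V) (f df : V -> R[i]) n :
  cdiff x f df ->
  cdiff x (fun y => f y ^+ n.+1) (fun v => n.+1%:R * f x ^+ n * df v).
Proof.
move=> cf; elim: n => [|n IH].
  by apply: (cdiff_ext cf) => v; rewrite ?expr1 // expr0 !mul1r.
apply: (cdiff_ext (cdiffM cf IH)) => v; first by rewrite [RHS]exprS.
by rewrite (exprS _ n) [n.+2%:R](natrD _ 1 n.+1); ring.
Qed.

Definition cexp_sum n z : R[i] := \sum_(k < n) (k`!%:R)^-1 * z ^+ k.

Lemma cdiff_cexp_sum (V : normedModType R) (x : V) (f df : V -> R[i]) n :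
  cdiff x f df ->
  cdiff x (fun y => cexp_sum n.+1 (f y)) (fun v => df v * cexp_sum n (f x)).
Proof.
move=> cf; rewrite /cexp_sum; elim: n => [|n IH].
  apply: (cdiff_ext (cdiff_cst x 1)) => v.
    by rewrite big_ord1 expr0 fact0 invr1 mulr1.
  by rewrite big_ord0 mulr0.
have := cdiffD IH (cdiffMl ((n.+1)`!%:R)^-1 (cdiffX n cf)).
move/cdiff_ext; apply => v; first by rewrite [RHS]big_ord_recr.
rewrite [in RHS]big_ord_recr /= mulrDr; congr (_ + _).
rewrite factS natrM invfM.
have : n.+1%:R != 0 :> R[i] by rewrite pnatr_eq0.
have : n`!%:R != 0 :> R[i] by rewrite pnatr_eq0 -lt0n fact_gt0.
move: n.+1%:R n`!%:R => a b b0 a0.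
by field; rewrite a0 b0.
Qed.

Lemma Re_le_normc z : `|ReC z| <= Normc.normc z.
Proof.
by case: z => a b /=; rewrite -sqrtr_sqr ler_sqrt ?addr_ge0 ?sqr_ge0 // lerDl
  sqr_ge0.
Qed.

Lemma Im_le_normc z : `|ImC z| <= Normc.normc z.
Proof.
by case: z => a b /=; rewrite -sqrtr_sqr ler_sqrt ?addr_ge0 ?sqr_ge0 // lerDr
  sqr_ge0.
Qed.

Lemma normc_real (t : R) : Normc.normc (t%:C)%C = `|t|.
Proof. by rewrite /= expr0n /= addr0 sqrtr_sqr. Qed.

Lemma normc_cexp z : Normc.normc (cexp z) = expR (ReC z).
Proof.
rewrite /= !exprMn -mulrDr cos2Dsin2 mulr1 sqrtr_sqr.
by rewrite ger0_norm // expR_ge0.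
Qed.

Lemma normcX z n : Normc.normc (z ^+ n) = Normc.normc z ^+ n.
Proof.
elim: n => [|n IH]; first by rewrite !expr0 Normc.normc1.
by rewrite !exprS Normc.normcM IH.
Qed.

(* Mean value theorem on [0, 1] for [cexp_sum n.+1 (z t) * cexp (- (z t))],
   whose derivative telescopes to a single term. *)
Lemma cexp_sum_mean_value z n :
  `|ReC (cexp_sum n.+1 z * cexp (- z)) - 1| <=
     Normc.normc z ^+ n.+1 / n`!%:R * expR `|ReC z| /\
  `|ImC (cexp_sum n.+1 z * cexp (- z))| <=
     Normc.normc z ^+ n.+1 / n`!%:R * expR `|ReC z|.
Proof.
pose f (t : R) := cexp_sum n.+1 (z * t%:C%C) * cexp (- (z * t%:C%C)).
pose d (t : R) : R[i] := - (z * (n`!%:R^-1 * (z * t%:C%C) ^+ n) * cexp (- (z *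
  t%:C%C))).
have fd t : cdiff t f (fun v : R => v%:C%C * d t).
  have ct : cdiff t (fun t : R => z * t%:C%C) (fun v : R => z * v%:C%C).
    by apply: cdiffMl; split; [exact: is_diff_id | exact: is_diff_cst].
  have := cdiffM (cdiff_cexp_sum n ct) (cdiff_cexp (cdiffN ct)).
  move/cdiff_ext; apply => // v; rewrite /d /cexp_sum big_ord_recr /=; ring.
(* On [0, 1] the power [t ^+ n] is at most 1, and the modulus of [cexp (- (z * t))] is the
   exponential of a real number of size at most [|ReC z|]. *)
have dB t : 0 <= t <= 1 ->
    Normc.normc (d t) <= Normc.normc z ^+ n.+1 / n`!%:R * expR `|ReC z|.
  move=> /andP[t0 t1].
  have tn : Normc.normc t%:C%C = t by rewrite normc_real ger0_norm.
  have nn : Normc.normc (n`!%:R^-1 : R[i]) = n`!%:R^-1.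
    by rewrite Normc.normcV -(rmorph_nat (real_complex R)) normc_real ger0_norm.
  have z0 : 0 <= Normc.normc z := le_trans (normr_ge0 _) (Re_le_normc z).
  rewrite /d normcN 2!Normc.normcM normc_cexp.
  rewrite Normc.normcM nn normcX Normc.normcM tn.
  have zt0 : 0 <= Normc.normc z * t by rewrite mulr_ge0.
  rewrite ler_pM ?expR_ge0 ?mulr_ge0 ?exprn_ge0 //.
    rewrite mulrCA mulrC exprS ler_wpM2r // ler_wpM2l //.
    rewrite lerXn2r ?nnegrE ?mulr_ge0 //.
    by rewrite ler_piMr.
  rewrite ler_expR (le_trans (ler_norm _)) //.
  rewrite ReCN ReCM /= mulr0 subr0 normrN normrM (ger0_norm t0).
  by rewrite ler_piMr.
have f1 : f 1 = cexp_sum n.+1 z * cexp (- z).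
  by rewrite /f (_ : 1%:C%C = 1) ?mulr1.
have f0 : f 0 = 1.
  rewrite /f (_ : 0%:C%C = 0) ?mulr0 // oppr0 cexp0 mulr1 /cexp_sum
    big_ord_recl.
  by rewrite big1 => [|k _]; rewrite ?expr0 ?fact0 ?invr1 ?mulr1 ?addr0 //
    expr0n mulr0.
rewrite -f1; split.
  have [t _|t t01] := @is_diff_MVT (fun t => ReC (f t)) (fun t => ReC (d t)).
    have [+ _] := fd t; move/is_diff_ext; apply => // v.
    by rewrite ReCM /= mul0r subr0.
  by rewrite f0 /= => ->; apply: le_trans (Re_le_normc _) (dB _ t01).
have [t _|t t01] := @is_diff_MVT (fun t => ImC (f t)) (fun t => ImC (d t)).
  have [_ +] := fd t; move/is_diff_ext; apply => // v.
  by rewrite ImCM /= mul0r addr0.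
by rewrite f0 /= subr0 => ->; apply: le_trans (Im_le_normc _) (dB _ t01).
Qed.

Definition ccvg (f : nat -> R[i]) (z : R[i]) : Prop :=
  ReC (f n) @[n --> \oo] --> ReC z /\ ImC (f n) @[n --> \oo] --> ImC z.

(** The product [P n] of the partial sum and [cexp (- z)] tends to 1: the mean value bound [b n] is
    a constant times a term of the exponential series, and those terms tend to 0. Multiplying by
    [cexp z] gives the limit. *)
Lemma ccvg_cexp_sum z : ccvg (fun n => cexp_sum n z) (cexp z).
Proof.
pose P n := cexp_sum n z * cexp (- z).
pose b n := Normc.normc z ^+ n.+1 / n`!%:R * expR `|ReC z|.
have b0 : b n @[n --> \oo] --> (0 : R).
  have -> : b = (fun n => (Normc.normc z * expR `|ReC z|) * exp_coeff
    (Normc.normc z) n).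
    by apply/funext => n; rewrite /b /exp_coeff /= exprS; ring.
  rewrite -[X in _ --> X](mulr0 (Normc.normc z * expR `|ReC z|)).
  by apply: cvgMr; exact: cvg_exp_coeff.
have R1 : ReC (P n) @[n --> \oo] --> (1 : R).
  rewrite -cvg_shiftS; apply/cvgrPdist_le => e e0.
  have /cvgrPdist_le/(_ e e0) := b0; apply: filterS => n /=.
  rewrite sub0r normrN distrC => H; apply: le_trans H.
  by apply: le_trans (proj1 (cexp_sum_mean_value z n)) (ler_norm _).
have I1 : ImC (P n) @[n --> \oo] --> (0 : R).
  rewrite -cvg_shiftS; apply/cvgrPdist_le => e e0.
  have /cvgrPdist_le/(_ e e0) := b0; apply: filterS => n /=.
  rewrite !sub0r !normrN => H; apply: le_trans H.
  by apply: le_trans (proj2 (cexp_sum_mean_value z n)) (ler_norm _).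
have e n : cexp_sum n z = P n * cexp z by rewrite /P -mulrA [_ * cexp z]mulrC
  cexpN mulr1.
split.
  rewrite (_ : (fun n => _) =
    (fun n => ReC (P n) * ReC (cexp z) - ImC (P n) * ImC (cexp z))); last first.
    by apply/funext => n; rewrite e ReCM.
  rewrite -[X in _ --> X](subr0) -[X in _ --> X - _]mul1r -[X in _ --> _ -
    X](mul0r (ImC (cexp z))).
  by apply: cvgB; apply: cvgMl.
rewrite (_ : (fun n => _) =
  (fun n => ReC (P n) * ImC (cexp z) + ImC (P n) * ReC (cexp z))); last first.
  by apply/funext => n; rewrite e ImCM.
rewrite -[X in _ --> X](addr0) -[X in _ --> X + _]mul1r -[X in _ --> _ +
  X](mul0r (ReC (cexp z))).
by apply: cvgD; apply: cvgMl.
Qed.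

End Exp.

(** * Rays from the origin and the principal logarithm *)

Section Rays.
Variable R : realType.

Lemma cdiff_comp (U V : normedModType R) (x : U) (g dg : U ->
  V) (f df : V -> R[i]) :
  is_diff x g dg -> cdiff (g x) f df ->
  cdiff x (fun y => f (g y)) (fun v => df (dg v)).
Proof.
move=> gg [f1 f2]; split; first exact: (is_diff_comp gg f1).
exact: (is_diff_comp gg f2).
Qed.

(** Along the ray, [t |-> f (t *: x)] has zero derivative, and the mean value theorem applies to its
    real and imaginary parts separately. *)
Lemma cdiff0_ray (V : normedModType R) (x : V) (f : V -> R[i]) :
  (forall t : R, 0 <= t <= 1 -> cdiff (t *: x) f (fun=> 0)) -> f x = f 0.
Proof.
move=> H.
have H1 (t : R) : 0 <= t <= 1 -> cdiff t (fun t : R => f (t *: x)) (fun=> 0).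
  move=> t01; exact: (cdiff_comp (is_diff_scalel t x) (H t t01)).
rewrite -{1}[x]scale1r -[in RHS](scale0r x).
apply: complex_ext.
  have [t t01|t _ /eqP] := @is_diff_MVT R (fun t => ReC (f (t *: x))) (fun=> 0).
    by apply: is_diff_ext (proj1 (H1 t t01)) _ _ => // v /=; rewrite mulr0.
  by rewrite subr_eq0 => /eqP.
have [t t01|t _ /eqP] := @is_diff_MVT R (fun t => ImC (f (t *: x))) (fun=> 0).
  by apply: is_diff_ext (proj2 (H1 t t01)) _ _ => // v /=; rewrite mulr0.
by rewrite subr_eq0 => /eqP.
Qed.

(* Only meaningful on the half-plane [0 < ReC z]. *)
Definition plog (z : R[i]) : R[i] :=
  (ln (ReC z ^+ 2 + ImC z ^+ 2) / 2 +i* atan (ImC z / ReC z))%C.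

Lemma plog1 : plog 1 = 0.
Proof.
by apply: complex_ext; rewrite /= ?mul0r ?atan0 // expr1n expr0n addr0 ln1
  mul0r.
Qed.

(** With z = a + ib, the differentials of ln(a^2 + b^2) / 2 and atan(b / a) are the real and
    imaginary parts of dz / z. *)
Lemma cdiff_plog (V : normedModType R) (x : V) (f df : V -> R[i]) :
  cdiff x f df -> 0 < ReC (f x) ->
  cdiff x (fun y => plog (f y)) (fun v => df v / f x).
Proof.
move=> cf f0; have [f1 f2] := cf.
have r0 : ReC (f x) != 0 by rewrite gt_eqF.
have z0 : f x != 0 by apply: contraTneq f0 => ->; rewrite ltxx.
have n0 : 0 < ReC (f x) ^+ 2 + ImC (f x) ^+ 2.
  by rewrite ltr_pwDl ?exprn_gt0 // sqr_ge0.
have dn := is_diffD (is_diff_mul f1 f1) (is_diff_mul f2 f2).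
have dn' : is_diff x (fun y => ReC (f y) ^+ 2 + ImC (f y) ^+ 2)
  (fun v => 2 * (ReC (f x) * ReC (df v) + ImC (f x) * ImC (df v))).
  by apply: (is_diff_ext dn) => v; rewrite !fctE /=; [rewrite !expr2 | ring].
have dl := is_diff_comp_real (f := fun y => ReC (f y) ^+ 2 + ImC (f y) ^+ 2)
  (is_derive1_ln n0) dn'.
have dV : is_derive (ReC (f x)) 1 (fun t : R => t^-1) (- (ReC (f x) ^- 2)).
  have := is_deriveV r0 (is_derive_id (ReC (f x)) (1 : R)).
  by rewrite scaler1.
have dq := is_diff_mul f2 (is_diff_comp_real dV f1).
have da := is_diff_comp_real (f := fun y => ImC (f y) * (ReC (f y))^-1)
  (is_derive1_atan _) dq.
have e z : z^-1 = (ReC z / (ReC z ^+ 2 + ImC z ^+ 2) +i* - (ImC z / (ReC z ^+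
  2 + ImC z ^+ 2)))%C :> R[i].
  by case: z.
have n1 := lt0r_neq0 n0.
split.
  have c2 : is_diff x (fun=> 2^-1 : R) (fun=> 0) by exact: is_diff_cst.
  apply: (is_diff_ext (is_diff_mul dl c2)) => // v.
  by rewrite e ReCM /=; field.
apply: (is_diff_ext da) => // v.
rewrite e ImCM /=; field.
by rewrite r0 n1.
Qed.
End Rays.

(** * Functions with continuous partial derivatives *)

Section ContinuousPartials.
Variables (R : realType) (r : nat).
Local Notation V := 'rV[R]_r.
Implicit Types (f : V -> R) (x y : V).

(** Along a coordinate line the one-variable difference quotients are exactly those of the
    directional derivative. *)
Lemma is_diff_axis f y (j : 'I_r) (t : R) :
  (forall x, derivable f x (axis R j)) ->
  is_diff t (fun s => f (y + s *: axis R j))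
    (fun v => v * 'D_(axis R j) f (y + t *: axis R j)).
Proof.
move=> df; set v := axis R j; set a := y + t *: v.
pose g (s : R) := f (y + s *: v).
have E : (fun h : R => h^-1 *: ((g \o shift t) (h *: 1) - g t)) =
         (fun h : R => h^-1 *: ((f \o shift a) (h *: v) - f a)).
  apply/funext => h; rewrite /g /= [h *: 1]mulr1 scalerDl addrCA.
  by rewrite -/a.
have dg : derivable g t 1 by rewrite /derivable E; exact: df.
have e : 'D_1 g t = 'D_v f a by rewrite /derive E.
split; first exact/derivable1_diffP.
by rewrite (deriv1E dg) derive1E e.
Qed.

Lemma axis_increment f y (j : 'I_r) (s c e : R) :
  (forall x, derivable f x (axis R j)) ->
  (forall t : R, 0 <= t <= 1 -> `|'D_(axis R j) f (y + (t * s) *: axis R j) -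
    c| <= e) ->
  `|f (y + s *: axis R j) - f y - s * c| <= e * `|s|.
Proof.
move=> df H.
pose d t := s * 'D_(axis R j) f (y + (t * s) *: axis R j).
have [t t01|t t01] := @is_diff_MVT R (fun t => f (y + (t * s) *: axis R j)) d.
  have := is_diff_comp (is_diff_scalel t s) (is_diff_axis y (t *: s) df).
  by move/is_diff_ext; apply => // v; rewrite /d /= mulrA.
rewrite mul1r mul0r scale0r addr0 => ->.
by rewrite /d -mulrBr normrM mulrC ler_wpM2r // H.
Qed.

Definition grad f x : V -> R := fun v =>
  \sum_(mu < r) v 0 mu * 'D_(axis R mu) f x.

Lemma grad_linear f x : linear (grad f x).
Proof.
move=> a u v; rewrite /grad scaler_sumr -big_split /=; apply: eq_bigr => mu _.
by rewrite !mxE mulrDl scalerAl.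
Qed.

HB.instance Definition _ f x := GRing.isLinear.Build _ _ _ _ _ (grad_linear f
  x).

Lemma grad_continuous f x : continuous (grad f x).
Proof.
have E : grad f x = \sum_(mu < r) (fun v : V => v 0 mu * 'D_(axis R mu) f x).
  by apply/funext => v; rewrite fct_sumE.
rewrite E; elim/big_ind: _ => [|g h cg ch y|mu _ y].
- exact: cst_continuous.
- exact: (continuousD (cg y) (ch y)).
- apply: (@continuousM _ _ (fun v : V => v 0 mu) (cst _));
  last exact: cst_continuous.
  exact: coord_continuous.
Qed.

(** The path from [x] to [x + h] moves one coordinate at a time: step [j] starts when the
    coordinates below [j] have already moved. *)
Lemma increment_telescope f x (h : V) :
  f (x + h) - f x = \sum_(j < r)
    (f (x + \sum_(i < r | (i < j)%N) h 0 i *: axis R i + h 0 j *: axis R j)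
     - f (x + \sum_(i < r | (i < j)%N) h 0 i *: axis R i)).
Proof.
pose s (n : nat) : V := \sum_(i < r | (i < n)%N) h 0 i *: axis R i.
have sS (j : 'I_r) : s j + h 0 j *: axis R j = s j.+1.
  rewrite /s [RHS](bigD1 j) //= addrC; congr (_ + _).
  by apply: eq_bigl => i; rewrite ltnS ltn_neqAle andbC.
have hs : h = s r.
  by rewrite [LHS]row_sum_delta /s; apply: eq_big => // i; rewrite ltn_ord.
rewrite {1}hs.
have -> : f x = f (x + s 0%N) by rewrite /s big_pred0 ?addr0.
rewrite -(telescope_sumr (fun n => f (x + s n))) // big_mkord.
by apply: eq_bigr => j _; rewrite -addrA sS.
Qed.

Lemma normr_coord_le (v : V) i : `|v 0 i| <= `|v|.
Proof.
have -> : `|v| = \big[Order.max/0]_ij `|v ij.1 ij.2| by rewrite -mx_normrE.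
exact: (le_bigmax _ (fun ij : 'I_1 * 'I_r => `|v ij.1 ij.2|) (0, i)).
Qed.

Lemma row_normr_le (v : V) (e : R) :
  0 <= e -> (forall i, `|v 0 i| <= e) -> `|v| <= e.
Proof.
move=> e0 H.
have -> : `|v| = \big[Order.max/0]_ij `|v ij.1 ij.2| by rewrite -mx_normrE.
apply: bigmax_le => // -[i j] _ /=; rewrite (ord1 i); exact: H.
Qed.

(** Continuity of the partial derivatives makes the error of each axis step small compared with
    [|h 0 j|]; summing over the axis path leaves a remainder of size at most [e * |h|]. *)
Lemma is_diff_partials f x :
  (forall mu y, derivable f y (axis R mu)) ->
  (forall mu, continuous (fun y => 'D_(axis R mu) f y)) ->
  is_diff x f (grad f x).
Proof.
move=> df cf.
have E : f \o shift x = cst (f x) + grad f x +o_ (0 : V) id.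
  apply/eqaddoP => e e0.
  (* Division by [r.+1] avoids a zero denominator and still keeps the sum of [r] errors below the
     bound. *)
  have e1 : 0 < e / r.+1%:R by rewrite divr_gt0.
  have : \forall y \near x, forall mu,
      `|'D_(axis R mu) f x - 'D_(axis R mu) f y| <= e / r.+1%:R.
    apply: (@filter_forall V 'I_r (fun mu y =>
      is_true (`|'D_(axis R mu) f x - 'D_(axis R mu) f y| <= e / r.+1%:R))
        (nbhs x)) => mu.
    by have /cvgrPdist_le/(_ _ e1) := cf mu x.
  move=> /nbhs_ballP[d /= d0 dH]; apply/nbhs_ballP; exists d => // h.
  rewrite -ball_normE /= sub0r normrN => hd.
  have step (j : 'I_r) :
     `|f (x + \sum_(i < r | (i < j)%N) h 0 i *: axis R i + h 0 j *: axis R j)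
     - f (x + \sum_(i < r | (i < j)%N) h 0 i *: axis R i)
     - h 0 j * 'D_(axis R j) f x| <= e / r.+1%:R * `|h 0 j|.
    apply: axis_increment => // t /andP[t0 t1]; rewrite distrC; apply: dH.
    rewrite -ball_normE /= opprD addrA opprD addrA subrr sub0r -opprD normrN.
    apply: le_lt_trans hd; apply: row_normr_le => // i.
    rewrite mxE summxE mxE mxE eqxx /=.
    (* Coordinate [i] of the displacement from [x] is [h 0 i] below [j], 0 above [j], and
       [t * h 0 j] at [j], so its sup norm is at most [|h|]. *)
    have [ij|ji|ij] := ltngtP i j.
    - rewrite (bigD1 i) //= big1 => [|k /andP[_ ki]].
        rewrite !mxE !eqxx /= mulr1 addr0 (_ : i == j = false) ?mulr0 ?addr0
          ?normr_coord_le //.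
        by apply: contraTF ij => /eqP ->; rewrite ltnn.
      by rewrite !mxE eqxx /= [i == k]eq_sym (negbTE ki) mulr0.
    - rewrite big1 => [|k kj].
        rewrite (_ : i == j = false) ?mulr0 ?addr0 ?normr0 //.
        by apply: contraTF ji => /eqP ->; rewrite ltnn.
      rewrite !mxE eqxx /= (_ : i == k = false) ?mulr0 //.
      by apply: contraTF kj => /eqP <-; rewrite -leqNgt ltnW.
    - rewrite big1 => [|k kj].
        move/val_inj: ij => ->; rewrite eqxx mulr1 add0r normrM (ger0_norm t0).
        by apply: le_trans (normr_coord_le _ j); rewrite ler_piMl.
      rewrite !mxE eqxx /= (_ : i == k = false) ?mulr0 //.
      by apply: contraTF kj => /eqP <-; rewrite ij ltnn.
  rewrite !fctE /= opprD addrA [h + x]addrC increment_telescope /grad -sumrB.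
  apply: le_trans (ler_norm_sum _ _ _) _.
  apply: (@le_trans _ _ (\sum_(j < r) e / r.+1%:R * `|h|)).
    apply: ler_sum => j _; apply: le_trans (step j) _.
    by rewrite ler_wpM2l ?(ltW e1) // normr_coord_le.
  rewrite sumr_const card_ord -[X in X <= _]mulr_natl mulrA ler_wpM2r //.
  by rewrite mulrCA ler_piMr ?(ltW e0) // ler_pdivrMr // mul1r ler_nat.
have D := diff_unique (@grad_continuous f x) E.
split=> //; apply/diff_locallyP; rewrite D; split => //.
exact: grad_continuous.
Qed.

End ContinuousPartials.

(** * Logarithms of nowhere vanishing functions *)

Section LogLift.
Variables (R : realType) (r : nat).
Local Notation V := 'rV[R]_r.

(** Differentiability depends only on the germ at [x]: the first-order expansion of [f] is also one
    of [g]. *)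
Lemma is_diff_near (V' : normedModType R) (x : V') (f g df : V' -> R) :
  is_diff x f df -> (\forall y \near x, f y = g y) -> is_diff x g df.
Proof.
move=> [dfx e] fg.
have [cd E] := proj1 (diff_locallyP _ _) dfx.
have gE : g \o shift x = cst (g x) + 'd f x +o_ (0 : V') id.
  apply/eqaddoP => eps eps0; have /eqaddoP/(_ eps eps0) := E.
  have fgx := nbhs_singleton fg; move/nbhs0P: fg; apply: filterS2 => h fgh.
  rewrite (_ : (f \o shift x - _) h = (g \o shift x - (cst (g x) + 'd f x)) h)
    //.
  change (f (h + x) - (f x + 'd f x h) = g (h + x) - (g x + 'd f x h)).
  by rewrite fgx [h + x]addrC fgh.
have D := diff_unique cd gE.
by split; [apply/diff_locallyP; rewrite D | rewrite D].
Qed.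

Lemma cdiff_near (V' : normedModType R) (x : V') (f g df : V' -> R[i]) :
  cdiff x f df -> (\forall y \near x, f y = g y) -> cdiff x g df.
Proof.
move=> [f1 f2] fg; split.
  by apply: is_diff_near f1 _; apply: filterS fg => y ->.
by apply: is_diff_near f2 _; apply: filterS fg => y ->.
Qed.

Lemma cdiff_at0 (V' : normedModType R) (x : V') (f df : V' -> R[i]) :
  cdiff x f df -> df 0 = 0.
Proof.
move=> [[_ d1] [_ d2]]; apply: complex_ext.
  by rewrite -(congr1 (@^~ 0) d1) linear0.
by rewrite -(congr1 (@^~ 0) d2) linear0.
Qed.

Variables (u : V -> R[i]) (du : V -> V -> R[i]).
Hypotheses (u_diff : forall x, cdiff x u (du x)) (u_neq0 : forall x, u x != 0).

(** Both numbers have an imaginary part smaller in size than their real part, so their arguments are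
    below pi/4 and differ by less than pi/2. *)
Lemma Re_div_gt0 (a b : R[i]) :
  `|1 - ReC a| < 2^-1 -> `|ImC a| < 2^-1 ->
  `|1 - ReC b| < 2^-1 -> `|ImC b| < 2^-1 -> 0 < ReC (a / b).
Proof.
case: a b => a1 a2 [b1 b2] /=; rewrite !ltr_norml.
move=> /andP[h1 h2] /andP[h3 h4] /andP[h5 h6] /andP[h7 h8].
rewrite mulrN opprK.
set n := b1 ^+ 2 + b2 ^+ 2.
have n0 : 0 < n by rewrite /n; nra.
have -> : a1 * (b1 / n) + a2 * (b2 / n) = (a1 * b1 + a2 * b2) / n.
  by rewrite !mulrA -mulrDl.
by apply: divr_gt0 => //; nra.
Qed.

(** Near a point [x], all values of [u] divided by [u x] are close to 1, so [Re_div_gt0] applies to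
    their ratios; compactness of the closed ball makes the distance [e] uniform. *)
Lemma Re_quotient_gt0_ball (M : R) : exists2 e : R, 0 < e &
  forall y z, `|y| <= M -> `|z - y| < e -> 0 < ReC (u z / u y).
Proof.
pose K : set V := [set y | `|y| <= M].
have cK : compact K.
  apply: bounded_closed_compact.
    by exists M; split; [exact: num_real | move=> t Mt y /= /le_trans; apply;
      exact: ltW].
  apply: (@preimage_closed _ _ (fun y : V => `|y|) [set t | t <= M]);
    last exact: closed_le.
  by move=> y _; exact: norm_continuous.
have /compact_near_coveringP nc := cK.
pose P (e : R) (y : V) := forall z, `|z - y| < e -> 0 < ReC (u z / u y).
have H : \forall e \near (0 : R)^'+, K `<=` P e.
  apply: nc => x Kx.
  have cx := cdiffMl (u x)^-1 (u_diff x).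
  have [[/differentiable_continuous c1 _] [/differentiable_continuous c2 _]]
    := cx.
  have n1 : \forall y \near x, `|1 - ReC ((u x)^-1 * u y)| < 2^-1.
    have /cvgrPdist_lt/(_ 2^-1) := c1.
    by rewrite mulVf //=; apply; rewrite invr_gt0.
  have n2 : \forall y \near x, `|ImC ((u x)^-1 * u y)| < 2^-1.
    have h2 : 0 < 2^-1 :> R by rewrite invr_gt0.
    have /cvgrPdist_lt/(_ _ h2) := c2; apply: filterS => y.
    by rewrite mulVf //= sub0r normrN.
  have [d /= d0 dH] := proj1 (nbhs_ballP _ _) (filterI n1 n2).
  (* Halving [d] keeps both [y] and any [z] within [e] of it inside the ball of radius [d]. *)
  exists (ball x (d / 2), [set e | 0 < e < d / 2]) => /=.
    split; first by apply: nbhsx_ballx; rewrite divr_gt0.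
    near=> e; apply/andP; split; near: e.
      exact: nbhs_right_gt.
    by apply: nbhs_right_lt; rewrite divr_gt0.
  move=> [y e] /= [xy /andP[e0 ed]] z zy.
  have By : ball x d y by apply: le_ball xy;
    rewrite ler_pdivrMr // ler_pMr // ler1n.
  have Bz : ball x d z.
    rewrite [d]splitr; apply: ball_triangle xy _.
    by rewrite -ball_normE /= distrC (lt_trans zy).
  have [y1 y2] := dH _ By; have [z1 z2] := dH _ Bz.
  have := Re_div_gt0 z1 z2 y1 y2.
  by rewrite invfM invrK mulrACA mulVf ?mul1r.
near (0 : R)^'+ => e; exists e; first by near: e; exact: nbhs_right_gt.
by move=> y z yM; have /(_ y yM) : K `<=` P e; [near: e | apply].
Unshelve. all: by end_near. Qed.

(** Each ratio of consecutive values on the subdivided ray stays in the half-plane where [plog] is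
    differentiable, and the differentials of the summands telescope. *)
Lemma log_lift_ball (M : R) : 0 <= M -> exists L : V -> R[i], L 0 = 0 /\
  forall x, `|x| <= M -> cdiff x L (fun v => du x v / u x).
Proof.
move=> M0; have [e e0 He] := Re_quotient_gt0_ball M.
(* Consecutive points of the subdivision are at distance at most [M / N], which this choice makes
   smaller than [e]. *)
pose N := (Num.truncn (M / e)).+1.
have NM : M / N%:R < e.
  rewrite ltr_pdivrMr // mulrC -ltr_pdivrMr //.
  by rewrite /N; have /andP[] := truncn_itv (divr_ge0 M0 (ltW e0)).
pose a (k : nat) : R := k%:R / N%:R.
have a01 k : (k <= N)%N -> 0 <= a k <= 1.
  by move=> kN; rewrite divr_ge0 //= ler_pdivrMr // mul1r ler_nat.
exists (fun x => \sum_(k < N) plog (u (a k.+1 *: x) / u (a k *: x))); split.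
  by rewrite big1 // => k _; rewrite !scaler0 divff ?plog1.
move=> x xM.
have step (k : 'I_N) : cdiff x (fun y => plog (u (a k.+1 *: y) / u (a k *: y)))
   (fun v => du (a k.+1 *: x) (a k.+1 *: v) / u (a k.+1 *: x) -
             du (a k *: x) (a k *: v) / u (a k *: x)).
  have ca c : cdiff x (fun y => u (c *: y)) (fun v => du (c *: x) (c *: v)).
    exact: (cdiff_comp (is_diff_scaler c x) (u_diff (c *: x))).
  have := cdiff_plog (cdiffM (ca (a k.+1)) (cdiffV (ca (a k)) (u_neq0 _))).
  rewrite He; first last.
  - rewrite -scalerBl normrZ; apply: le_lt_trans NM.
    rewrite /a -mulrBl -natrB // subSnn mul1r ger0_norm //.
    by rewrite mulrC ler_wpM2r.
  - have /andP[a0 a1] := a01 k (ltnW (ltn_ord k)).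
    by rewrite normrZ ger0_norm // (le_trans _ xM) // ler_piMl.
  move=> /(_ isT)/cdiff_ext; apply => // v.
  by field; rewrite !u_neq0.
apply: (cdiff_ext (cdiff_sum step)) => // v.
rewrite -(big_mkord xpredT (fun k =>
  du (a k.+1 *: x) (a k.+1 *: v) / u (a k.+1 *: x) -
             du (a k *: x) (a k *: v) / u (a k *: x))).
rewrite (telescope_sumr (fun k => du (a k *: x) (a k *: v) / u (a k *: x))) //.
(* The telescope ends at the wanted quotient for [a N = 1]; for [a 0 = 0] the term is
   [du 0 0 / u 0], which is 0. *)
have aN : a N = 1 by rewrite /a divff // pnatr_eq0.
have a0 : a 0%N = 0 by rewrite /a mul0r.
by rewrite aN a0 !scale1r !scale0r (cdiff_at0 (u_diff 0)) mul0r subr0.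
Qed.

(** The logarithms on balls of integer radius agree where both are defined, since their difference
    vanishes at 0 and has zero differential along rays; hence they glue. *)
Lemma log_lift : exists L : V -> R[i], [/\ L 0 = 0,
  forall x, cdiff x L (fun v => du x v / u x) &
  forall x, cexp (L x) * u 0 = u x].
Proof.
have [F HF] := choice (fun n : nat => log_lift_ball (ler0n R n)).
have F0 n : F n 0 = 0 by case: (HF n).
have dF n x : `|x| <= n%:R -> cdiff x (F n) (fun v => du x v / u x).
  by case: (HF n) => _; apply.
have FE n m x : `|x| <= n%:R -> `|x| <= m%:R -> F n x = F m x.
  move=> xn xm; apply/eqP; rewrite -subr_eq0; apply/eqP.
  rewrite (cdiff0_ray (f := fun y => F n y - F m y)) ?F0 ?subr0 // =>
    t /andP[t0 t1].
  have tx : `|t *: x| <= `|x| by rewrite normrZ ger0_norm // ler_piMl.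
  apply: (cdiff_ext (cdiffB (dF n _ (le_trans tx xn)) (dF m _ (le_trans tx
    xm)))) => // v.
  by rewrite subrr.
(* The successor makes [|x| < nn x] strict, so near [x] the glued function agrees with the single
   function [F (nn x)]. *)
pose nn (x : V) := (Num.truncn `|x|).+1.
have nnP x : `|x| < (nn x)%:R.
  by rewrite /nn; have /andP[] := truncn_itv (normr_ge0 x).
pose L x := F (nn x) x.
have dL x : cdiff x L (fun v => du x v / u x).
  apply: cdiff_near (dF _ _ (ltW (nnP x))) _.
  have : \forall y \near x, `|y| < (nn x)%:R.
    exact: (@cvgr_lt _ _ _ _ _ _ (@norm_continuous R V x) _ (nnP x)).
  by apply: filterS => y yx; apply: FE; apply: ltW.
have L0 : L 0 = 0 by exact: F0.
exists L; split => // x.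
(* The differential of [u * cexp (- L)] is zero, so this product keeps its value at 0. *)
have E : u x * cexp (- L x) = u 0 * cexp (- L 0).
  apply: (cdiff0_ray (f := fun y => u y * cexp (- L y))) => t _.
  apply: (cdiff_ext (cdiffM (u_diff _) (cdiff_cexp (cdiffN (dL _))))) => // v.
  by field; rewrite u_neq0.
rewrite L0 oppr0 cexp0 mulr1 in E.
by rewrite -E mulrCA cexpN mulr1.
Qed.

End LogLift.

(** * Coordinates in the Clifford algebra *)

Section Scalars.
Variables (R : realType) (k : base_field).
Local Notation F := (scalars R k).
Implicit Types z w : F.

(** Embeds either base field in [R[i]], so that both cases share one complex argument; injectivity
    brings identities back. *)
Definition sc_C z : R[i] := (sc_re z +i* sc_im z)%C.

Lemma sc_C_zmod : zmod_morphism sc_C.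
Proof.
rewrite /sc_C; case: k => [z w|[a b] [c d]] //.
by apply: complex_ext => /=; rewrite ?subrr.
Qed.

Lemma sc_C_monoid : monoid_morphism sc_C.
Proof.
rewrite /sc_C; case: k; split=> //; last by case=> a b [c d].
by move=> z w; apply: complex_ext; rewrite /= ?mulr0 ?mul0r ?subr0 ?addr0.
Qed.

HB.instance Definition _ := GRing.isZmodMorphism.Build F R[i] sc_C sc_C_zmod.
HB.instance Definition _ := GRing.isMonoidMorphism.Build F R[i] sc_C
  sc_C_monoid.

Lemma sc_C_inj : injective sc_C.
Proof. exact: fmorph_inj. Qed.

(** Over the reals [sc_mk] discards [b], hence the condition. *)
Lemma sc_C_mk (a b : R) : (k = Reals -> b = 0) ->
  sc_C (sc_mk k a b) = (a +i* b)%C.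
Proof. by rewrite /sc_C; case: k => //= /(_ erefl) ->. Qed.

Lemma sc_im_Reals z : k = Reals -> sc_im z = 0.
Proof. by move: z; case: k. Qed.

End Scalars.

Section Partials.
Variables (R : realType) (k : base_field) (p q r : nat).
Local Notation V := 'rV[R]_r.
Local Notation A := (Cl (scalars R k) p q).

Lemma ReC_sum n (f : 'I_n -> R[i]) : ReC (\sum_(j < n) f j) = \sum_(j < n) ReC
  (f j).
Proof. exact: (big_morph (@complex.Re R) (@ReCD R) erefl). Qed.

Lemma ImC_sum n (f : 'I_n -> R[i]) : ImC (\sum_(j < n) f j) = \sum_(j < n) ImC
  (f j).
Proof. exact: (big_morph (@complex.Im R) (@ImCD R) erefl). Qed.

Lemma sc_C_partial (f : V -> A) mu x i :
  sc_C (cl_partial mu f x 0 i) =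
  ('D_(axis R mu) (cl_re f i) x +i* 'D_(axis R mu) (cl_im f i) x)%C.
Proof.
rewrite mxE sc_C_mk // => kR.
rewrite (_ : cl_im f i = cst 0) ?derive_cst //.
by apply/funext => y; rewrite /cl_im sc_im_Reals.
Qed.

Lemma smooth_is_diff (f : V -> R) x : smooth f -> is_diff x f (grad f x).
Proof.
move=> sf; have /= [_ df cf] := sf 1%N.
by apply: is_diff_partials.
Qed.

Lemma cl_smooth_cdiff (f : V -> A) x i : cl_smooth f ->
  cdiff x (fun y => sc_C (f y 0 i))
    (fun v => \sum_(mu < r) (v 0 mu)%:C%C * sc_C (cl_partial mu f x 0 i)).
Proof.
move=> /(_ i)[sr si]; split.
  apply: (is_diff_ext (smooth_is_diff x sr)) => // v; rewrite ReC_sum.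
  by apply: eq_bigr => mu _; rewrite sc_C_partial ReCM /= mul0r subr0.
apply: (is_diff_ext (smooth_is_diff x si)) => // v; rewrite ImC_sum.
by apply: eq_bigr => mu _; rewrite sc_C_partial ImCM /= mul0r addr0.
Qed.

End Partials.

(** * Convergence by coordinates *)

Section Convergence.
Variable R : realType.

Lemma ccvgD f g (a b : R[i]) :
  ccvg f a -> ccvg g b -> ccvg (fun n => f n + g n) (a + b).
Proof.
move=> [f1 f2] [g1 g2]; split.
  rewrite ReCD (_ : (fun n => _) = (fun n => ReC (f n) + ReC (g n))).
    exact: cvgD.
  by apply/funext => n; rewrite ReCD.
rewrite ImCD (_ : (fun n => _) = (fun n => ImC (f n) + ImC (g n))).
  exact: cvgD.
by apply/funext => n; rewrite ImCD.
Qed.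

Lemma ccvgMl f (a c : R[i]) : ccvg f a -> ccvg (fun n => c * f n) (c * a).
Proof.
move=> [f1 f2]; split.
  rewrite ReCM (_ : (fun n => _) =
    (fun n => ReC c * ReC (f n) - ImC c * ImC (f n))).
    by apply: cvgB; apply: cvgMr.
  by apply/funext => n; rewrite ReCM.
rewrite ImCM (_ : (fun n => _) =
  (fun n => ReC c * ImC (f n) + ImC c * ReC (f n))).
  by apply: cvgD; apply: cvgMr.
by apply/funext => n; rewrite ImCM.
Qed.

Lemma sqrt_sqrD_le (a b : R) : Num.sqrt (a ^+ 2 + b ^+ 2) <= `|a| + `|b|.
Proof.
rewrite -[leRHS]ger0_norm ?addr_ge0 // -sqrtr_sqr ler_sqrt ?sqr_ge0 //.
rewrite sqrrD !real_normK ?num_real // lerD2r lerDl.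
by rewrite mulrn_wge0 // mulr_ge0.
Qed.

Variables (k : base_field) (p q : nat).
Local Notation A := (Cl (scalars R k) p q).

Lemma sc_cvg (f : nat -> scalars R k) z (e : scalars R k) : 0 < e ->
  ccvg (fun n => sc_C (f n)) (sc_C z) ->
  \forall n \near \oo, `|z - f n| < e.
Proof.
move: f z e; rewrite /sc_C; case: k => [f z e e0 [f1 _]|f z e e0 [f1 f2]].
  by have /cvgrPdist_lt/(_ e e0) := f1.
(* A positive element of [R[i]] is real; half of it is allotted to each of the real and imaginary
   parts. *)
move: e0; rewrite ltcE /= => /andP[/eqP eI eR].
have e2 : 0 < ReC e / 2 by rewrite divr_gt0.
have /cvgrPdist_lt/(_ _ e2) n1 := f1.
have /cvgrPdist_lt/(_ _ e2) n2 := f2.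
near=> n.
have h1 : `|ReC z - ReC (f n)| < ReC e / 2 by near: n; exact: n1.
have h2 : `|ImC z - ImC (f n)| < ReC e / 2 by near: n; exact: n2.
rewrite ltcE normc_def /= -eI eqxx /=.
apply: le_lt_trans (sqrt_sqrD_le _ _) _.
by rewrite [ReC e]splitr ReCD ImCD ReCN ImCN ltrD.
Unshelve. all: by end_near. Qed.

Lemma cl_cvg (S : nat -> A) (W : A) :
  (forall i, ccvg (fun n => sc_C (S n 0 i)) (sc_C (W 0 i))) ->
  S @ \oo --> W.
Proof.
move=> H; apply/cvg_ballP => e e0.
have : \forall n \near \oo, forall i, `|W 0 i - S n 0 i| < e.
  apply: (@filter_forall nat 'I_4 (fun i n =>
    is_true (`|W 0 i - S n 0 i| < e))).
  by move=> i; exact: sc_cvg.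
apply: filterS => n Hn; split=> // i j; rewrite (ord1 i).
by rewrite -ball_normE; exact: Hn.
Qed.

End Convergence.

(** * The even subalgebra and its characters *)

Section EvenPart.
Variables (F : fieldType) (p q : nat).
Local Notation A := (Cl F p q).
Local Notation s := (eta F p q 0 0).
Local Notation t := (eta F p q 1 1).
Implicit Types U W : A.

Lemma eta_sqr (a : 'I_2) : eta F p q a a * eta F p q a a = 1.
Proof.
rewrite !mxE eqxx !mulr1n.
by case: ifP => _; rewrite ?mulr1 // mulrNN mulr1.
Qed.

Lemma cl_mk0 a b c d : cl_mk p q a b c d 0 0 = a :> F.
Proof. by case: (cl_mkE p q a b c d). Qed.
Lemma cl_mk1 a b c d : cl_mk p q a b c d 0 1 = b :> F.
Proof. by case: (cl_mkE p q a b c d). Qed.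
Lemma cl_mk2 a b c d : cl_mk p q a b c d 0 2 = c :> F.
Proof. by case: (cl_mkE p q a b c d). Qed.
Lemma cl_mk3 a b c d : cl_mk p q a b c d 0 3 = d :> F.
Proof. by case: (cl_mkE p q a b c d). Qed.
Definition cl_mk_coord := (cl_mk0, cl_mk1, cl_mk2, cl_mk3).

Lemma cl_mulE U W : U * W = cl_mk p q
  (U 0 0 * W 0 0 + s * U 0 1 * W 0 1 + t * U 0 2 * W 0 2 - s * t * U 0 3 * W 0
    3)
  (U 0 0 * W 0 1 + U 0 1 * W 0 0 - t * U 0 2 * W 0 3 + t * U 0 3 * W 0 2)
  (U 0 0 * W 0 2 + U 0 2 * W 0 0 + s * U 0 1 * W 0 3 - s * U 0 3 * W 0 1)
  (U 0 0 * W 0 3 + U 0 3 * W 0 0 + U 0 1 * W 0 2 - U 0 2 * W 0 1).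
Proof. by []. Qed.

Lemma cl_oneE : 1 = cl_mk p q 1 0 0 0 :> A.
Proof. by []. Qed.

Lemma cl_e12E : cl_e12 F p q = cl_mk p q 0 0 0 1.
Proof.
by apply: cl_ext; rewrite /cl_e12 /cl_gen /= cl_mulE !cl_mk_coord; ring.
Qed.

Lemma cl_mk_mul a b c d a' b' c' d' :
  cl_mk p q a b c d * cl_mk p q a' b' c' d' = cl_mk p q
  (a * a' + s * b * b' + t * c * c' - s * t * d * d')
  (a * b' + b * a' - t * c * d' + t * d * c')
  (a * c' + c * a' + s * b * d' - s * d * b')
  (a * d' + d * a' + b * c' - c * b') :> A.
Proof. by rewrite cl_mulE !cl_mk_coord. Qed.

Lemma cl_mk_add a b c d a' b' c' d' :
  cl_mk p q a b c d + cl_mk p q a' b' c' d' =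
  cl_mk p q (a + a') (b + b') (c + c') (d + d') :> A.
Proof. by apply: cl_ext; rewrite cl_addE !cl_mk_coord. Qed.

Lemma cl_mk_scale x a b c d :
  x *: cl_mk p q a b c d = cl_mk p q (x * a) (x * b) (x * c) (x * d) :> A.
Proof. by apply: cl_ext; rewrite cl_scaleE !cl_mk_coord. Qed.

Lemma cl_mk_eta U : U = cl_mk p q (U 0 0) (U 0 1) (U 0 2) (U 0 3).
Proof. by apply: cl_ext; rewrite !cl_mk_coord. Qed.

(** The element [a + b * e12] of the even subalgebra, which is commutative. *)
Definition cl_ev (a b : F) : A := cl_mk p q a 0 0 b.

Lemma cl_ev_mul a b a' b' :
  cl_ev a b * cl_ev a' b' = cl_ev (a * a' - s * t * b * b') (a * b' + b * a').
Proof. by rewrite /cl_ev cl_mk_mul; congr cl_mk; ring. Qed.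

Variables (K : fieldType) (iota : {rmorphism F -> K}).

(* On the even subalgebra this is the character [e12 |-> l] when
   [l ^+ 2 = e12 ^+ 2 = - (s * t)]. *)
Definition cl_char (l : K) U : K := iota (U 0 0) + l * iota (U 0 3).

Lemma cl_char_ev l a b : cl_char l (cl_ev a b) = iota a + l * iota b.
Proof. by rewrite /cl_char !cl_mk_coord. Qed.

Lemma cl_char_mul l a b a' b' : l ^+ 2 = - iota (s * t) ->
  cl_char l (cl_ev a b * cl_ev a' b') = cl_char l (cl_ev a b) * cl_char l
    (cl_ev a' b').
Proof.
move=> l2; rewrite cl_ev_mul !cl_char_ev !(rmorphD, rmorphB, rmorphM, rmorphN).
have -> : - (iota s * iota t * iota b * iota b') = l ^+ 2 * iota b * iota b'.
  by rewrite l2 rmorphM !mulNr.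
ring.
Qed.

(** The sum of the two characters is [2 * iota a]; once [a] is known, one of them determines [b]. *)
Lemma cl_char_inj l a b a' b' : l != 0 -> 2 != 0 :> K ->
  cl_char l (cl_ev a b) = cl_char l (cl_ev a' b') ->
  cl_char (- l) (cl_ev a b) = cl_char (- l) (cl_ev a' b') ->
  cl_ev a b = cl_ev a' b'.
Proof.
move=> l0 n2; rewrite !cl_char_ev => E1 E2.
have Ea : a = a'.
  apply: (fmorph_inj iota); apply: (mulfI n2).
  have -> : 2 * iota a = (iota a + l * iota b) + (iota a + - l * iota b) by
    ring.
  by rewrite E1 E2; ring.
have Eb : b = b'.
  apply: (fmorph_inj iota); apply: (mulfI l0).
  by move: E1; rewrite Ea => /addrI.
by rewrite Ea Eb.
Qed.

End EvenPart.

(** * The exponential of even elements *)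

Section ExpEven.
Variables (R : realType) (k : base_field) (p q : nat).
Local Notation F := (scalars R k).
Local Notation A := (Cl F p q).
Local Notation s := (eta F p q 0 0).
Local Notation t := (eta F p q 1 1).
Local Notation iota := (@sc_C R k).

Definition cl_exp_sum (U : A) n : A :=
  series (fun k : nat => (k`!%:R)^-1 *: U ^+ k) n.

(** The coordinates of a power stay implicit; only their images under the characters are recorded,
    and these determine them. *)
Lemma cl_ev_exp (a b : F) n : exists a' b', cl_ev p q a b ^+ n = cl_ev p q a'
  b' /\
  forall l : R[i], l ^+ 2 = - iota (s * t) ->
    cl_char iota l (cl_ev p q a' b') = cl_char iota l (cl_ev p q a b) ^+ n.
Proof.
elim: n => [|n [a' [b' [E H]]]].
  exists 1, 0; split=> // l _; rewrite cl_char_ev rmorph1 rmorph0 mulr0 addr0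
    //.
exists (a * a' - s * t * b * b'), (a * b' + b * a'); rewrite -cl_ev_mul; split.
  by rewrite exprS E.
by move=> l l2; rewrite cl_char_mul // H // exprS.
Qed.

Lemma cl_exp_sum_ev (a b : F) n : exists a' b',
  cl_exp_sum (cl_ev p q a b) n = cl_ev p q a' b' /\
  forall l : R[i], l ^+ 2 = - iota (s * t) ->
    cl_char iota l (cl_ev p q a' b') = cexp_sum n (cl_char iota l (cl_ev p q a
      b)).
Proof.
elim: n => [|n [a1 [b1 [E H]]]].
  exists 0, 0; split.
    rewrite /cl_exp_sum /series /= big_geq //.
    by apply: cl_ext; rewrite /cl_ev !cl_mk_coord mxE.
  by move=> l _; rewrite cl_char_ev rmorph0 mulr0 addr0 /cexp_sum big_ord0.
have [a2 [b2 [E2 H2]]] := cl_ev_exp a b n.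
exists (a1 + (n`!%:R)^-1 * a2), (b1 + (n`!%:R)^-1 * b2); split.
  rewrite /cl_exp_sum seriesSr -/(cl_exp_sum _ _) E E2 /cl_ev cl_mk_scale
    cl_mk_add.
  by rewrite mulr0 addr0.
move=> l l2; rewrite /cexp_sum big_ord_recr /= -/(cexp_sum _ _) -H // -H2 //.
rewrite !cl_char_ev !rmorphD !rmorphM fmorphV rmorph_nat; ring.
Qed.

(** The characters turn the partial sums into complex exponential sums. Solving for the two
    coordinates in terms of the characters at [l] and [- l] shows that the coordinates converge. *)
Lemma cl_exp_ev (a b : F) (l : R[i]) : l != 0 -> l ^+ 2 = - iota (s * t) ->
  exists a' b', cl_exp (cl_ev p q a b) = cl_ev p q a' b' /\
  forall l' : R[i], l' = l \/ l' = - l ->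
    cl_char iota l' (cl_ev p q a' b') = cexp (cl_char iota l' (cl_ev p q a b)).
Proof.
move=> l0 l2.
have l2' : (- l) ^+ 2 = - iota (s * t) by rewrite sqrrN.
pose zp := cl_char iota l (cl_ev p q a b).
pose zm := cl_char iota (- l) (cl_ev p q a b).
have [S HS] := choice (cl_exp_sum_ev a b).
have {HS}[T HT] := choice HS.
(* [e0] and [e3] solve [e0 + l * e3 = cexp zp] and [e0 - l * e3 = cexp zm]. *)
pose e0 := 2^-1 * (cexp zp + cexp zm).
pose e3 := (2 * l)^-1 * (cexp zp + -1 * cexp zm).
have n2 : 2 != 0 :> R[i] by rewrite pnatr_eq0.
have SE n : iota (S n) = 2^-1 * (cexp_sum n zp + cexp_sum n zm).
  by have [_ H] := HT n; rewrite -!H // !cl_char_ev; field.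
have TE n : iota (T n) = (2 * l)^-1 * (cexp_sum n zp + -1 * cexp_sum n zm).
  by have [_ H] := HT n; rewrite -!H // !cl_char_ev; field.
have cS : ccvg (fun n => iota (S n)) e0.
  rewrite (_ : (fun n => _) = fun n => 2^-1 * (cexp_sum n zp + cexp_sum n zm)).
    by apply: ccvgMl; apply: ccvgD; exact: ccvg_cexp_sum.
  exact/funext.
have cT : ccvg (fun n => iota (T n)) e3.
  rewrite (_ : (fun n => _) = fun n =>
    (2 * l)^-1 * (cexp_sum n zp + -1 * cexp_sum n zm)).
    by apply/ccvgMl/ccvgD; [|apply: ccvgMl]; exact: ccvg_cexp_sum.
  exact/funext.
(* Over the reals the limits must come from the base field; as limits of real sequences they have
   zero imaginary part. *)
have real_lim (f : nat -> F) z : ccvg (fun n => iota (f n)) z ->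
  k = Reals -> ImC z = 0.
  move=> [_ +] kR; rewrite (_ : (fun n => _) = cst 0).
    by move=> /cvg_lim <- //; rewrite lim_cst.
  by apply/funext => n /=; rewrite sc_im_Reals.
have E0 : iota (sc_mk k (ReC e0) (ImC e0)) = e0.
  by rewrite sc_C_mk; [case: (e0) | exact: real_lim cS].
have E3 : iota (sc_mk k (ReC e3) (ImC e3)) = e3.
  by rewrite sc_C_mk; [case: (e3) | exact: real_lim cT].
exists (sc_mk k (ReC e0) (ImC e0)), (sc_mk k (ReC e3) (ImC e3)); split.
  apply: cvg_lim; first exact: norm_hausdorff.
  apply: cl_cvg => i.
  have c0 : ccvg (fun n => iota 0) (iota 0) by split; exact: cvg_cst.
  have -> : (fun n => iota (series (fun k0 : nat =>
    k0`!%:R^-1 *: cl_ev p q a b ^+ k0) n 0 i))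
    = (fun n => iota (cl_ev p q (S n) (T n) 0 i)).
    by apply/funext => n; have [<- _] := HT n.
  have P4 (P : 'I_4 -> Prop) : P 0 -> P 1 -> P 2 -> P 3 -> P i.
    move=> P0 P1 P2 P3; case: (i) => -[|[|[|[|//]]]] Hi.
    - by rewrite (_ : Ordinal Hi = 0) //; apply: val_inj.
    - by rewrite (_ : Ordinal Hi = 1) //; apply: val_inj.
    - by rewrite (_ : Ordinal Hi = 2) //; apply: val_inj.
    - by rewrite (_ : Ordinal Hi = 3) //; apply: val_inj.
  apply: (P4 (fun i => ccvg (fun n => iota (cl_ev p q (S n) (T n) 0 i)) (iota
    (cl_ev p q (sc_mk k (ReC e0) (ImC e0)) (sc_mk k (ReC e3) (ImC e3)) 0 i)))).
  - rewrite cl_mk0 E0 (_ : (fun n => _) = fun n => iota (S n)) //.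
    by apply/funext => n; rewrite cl_mk0.
  - by rewrite cl_mk1 (_ : (fun n => _) = fun n => iota 0) //;
    apply/funext => n; rewrite cl_mk1.
  - by rewrite cl_mk2 (_ : (fun n => _) = fun n => iota 0) //;
    apply/funext => n; rewrite cl_mk2.
  - rewrite cl_mk3 E3 (_ : (fun n => _) = fun n => iota (T n)) //.
    by apply/funext => n; rewrite cl_mk3.
have C l' : cl_char iota l' (cl_ev p q (sc_mk k (ReC e0) (ImC e0))
    (sc_mk k (ReC e3) (ImC e3))) = e0 + l' * e3.
  by rewrite cl_char_ev; congr (_ + _ * _).
by move=> l' [] ->; rewrite C /e0 /e3 -/zp -/zm; field; rewrite ?l0 ?n2.
Qed.

End ExpEven.

(** * Conjugation of frames *)

Section Frames.
Variables (F : fieldType) (p q : nat).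
Local Notation A := (Cl F p q).
Local Notation s := (eta F p q 0 0).
Local Notation t := (eta F p q 1 1).
Local Notation ev := (cl_ev p q).
Local Notation e1 := (cl_gen F p q 0).
Local Notation e2 := (cl_gen F p q 1).

(** The matrix with rows [y] and [z] preserves the form diag(s, t), and [eps] is its determinant; up
    to this sign, the first row determines the second. *)
Lemma orthogonal_pair (y1 y2 z1 z2 : F) :
  s * y1 ^+ 2 + t * y2 ^+ 2 = s -> s * z1 ^+ 2 + t * z2 ^+ 2 = t ->
  s * y1 * z1 + t * y2 * z2 = 0 ->
  let eps := y1 * z2 - y2 * z1 in
  [/\ y1 ^+ 2 + s * t * y2 ^+ 2 = 1, z1 = - (s * t * eps * y2),
      z2 = eps * y1 & eps ^+ 2 = 1].
Proof.
have s2 := eta_sqr F p q 0; have t2 := eta_sqr F p q 1.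
move: s t s2 t2 => s t s2 t2 hy hz hyz eps.
have n1 : y1 ^+ 2 + s * t * y2 ^+ 2 = 1.
  have -> : y1 ^+ 2 + s * t * y2 ^+ 2 =
    s * (s * y1 ^+ 2 + t * y2 ^+ 2) + (1 - s * s) * y1 ^+ 2 by ring.
  by rewrite hy s2 subrr mul0r addr0.
have yz : y1 * z1 + s * t * y2 * z2 = 0.
  have -> : y1 * z1 + s * t * y2 * z2 =
    s * (s * y1 * z1 + t * y2 * z2) + (1 - s * s) * (y1 * z1) by ring.
  by rewrite hyz s2 subrr mulr0 mul0r addr0.
have E1 : z2 = eps * y1.
  have -> : eps * y1 = z2 * (y1 ^+ 2 + s * t * y2 ^+ 2)
    - y2 * (y1 * z1 + s * t * y2 * z2) by rewrite /eps; ring.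
  by rewrite n1 yz; ring.
have E2 : z1 = - (s * t * eps * y2).
  have -> : - (s * t * eps * y2) = z1 * (y1 ^+ 2 + s * t * y2 ^+ 2)
    - y1 * (y1 * z1 + s * t * y2 * z2) by rewrite /eps; ring.
  by rewrite n1 yz; ring.
(* Substituting the formulas for [z1] and [z2] in the norm equation of the second row gives
   [eps ^+ 2 = t * t]; the correction terms vanish because [s * s = t * t = 1]. *)
split => //; rewrite -[LHS]mulr1 -[in LHS]n1 -t2.
have -> : eps ^+ 2 * (y1 ^+ 2 + s * t * y2 ^+ 2) =
  t * (s * (- (s * t * eps * y2)) ^+ 2 + t * (eps * y1) ^+ 2)
  + (1 - s * s * (t * t)) * s * t * eps ^+ 2 * y2 ^+ 2
  + (1 - t * t) * eps ^+ 2 * y1 ^+ 2 by ring.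
by rewrite -E1 -E2 hz s2 t2; ring.
Qed.

Lemma cl_gen0_sqr : e1 * e1 = s%:A.
Proof. by rewrite /cl_gen /= cl_mk_mul cl_oneE cl_mk_scale; congr cl_mk;
  ring. Qed.

Lemma inv_unique (Z : unitRingType) (x y : Z) :
  x * y = 1 -> y * x = 1 -> x \is a GRing.unit /\ x^-1 = y.
Proof.
move=> xy yx; have ux : x \is a GRing.unit by apply/unitrP; exists y.
by split=> //; rewrite -[LHS]mulr1 -xy mulKr.
Qed.

(** [e12] anticommutes with each generator, so moving an even element across one conjugates it. *)
Lemma cl_ev_gen0 (a b : F) : e1 * ev a b = ev a (- b) * e1.
Proof. by rewrite /cl_gen /cl_ev /= !cl_mk_mul; congr cl_mk; ring. Qed.

Lemma cl_ev_gen1 (a b : F) : e2 * ev a b = ev a (- b) * e2.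
Proof. by rewrite /cl_gen /cl_ev /= !cl_mk_mul; congr cl_mk; ring. Qed.

Lemma cl_ev_comm (a b c d : F) : ev a b * ev c d = ev c d * ev a b.
Proof. by rewrite !cl_ev_mul; congr cl_ev; ring. Qed.

Lemma cl_ev_conj (a b : F) : ev a b * ev a (- b) = (a ^+ 2 + s * t * b ^+ 2)%:A.
Proof.
rewrite cl_ev_mul cl_oneE cl_mk_scale /cl_ev; congr cl_mk; ring.
Qed.

Lemma cl_ev_unit (a b : F) : a ^+ 2 + s * t * b ^+ 2 != 0 ->
  ev a b \is a GRing.unit.
Proof.
move=> n0; apply/unitrP; exists ((a ^+ 2 + s * t * b ^+ 2)^-1 *: ev a (- b)).
rewrite -scalerAl -scalerAr [ev a (- b) * _]cl_ev_comm cl_ev_conj scalerA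
  mulVf //.
by rewrite scale1r.
Qed.

Lemma cl_gen0_unit : e1 \is a GRing.unit.
Proof.
have s2 := eta_sqr F p q 0.
apply/unitrP; exists (s *: e1).
by rewrite -scalerAl -scalerAr cl_gen0_sqr scalerA s2 scale1r.
Qed.

(* The averaging of Pauli's theorem applied to 1, or to e1 when the frame has
   the opposite orientation, gives the even element 1 + g up to a factor; this
   is invertible unless g = -1, in which case e12 is an intertwiner. *)
Lemma frame_intertwiner (a b eps : F) : 2 != 0 :> F ->
  a ^+ 2 + s * t * b ^+ 2 = 1 -> eps ^+ 2 = 1 ->
  exists2 K : A, K \is a GRing.unit &
    ev a b * e1 * K = K * e1 /\ eps *: (ev a b * e2 * K) = K * e2.
Proof.
move=> n2 gn epsn.
have s2 := eta_sqr F p q 0; have t2 := eta_sqr F p q 1.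
have st0 : s * t != 0.
  apply/eqP => st0; have : s * t * (s * t) = 1 by rewrite mulrACA s2 t2 mulr1.
  by rewrite st0 mul0r => /eqP; rewrite eq_sym oner_eq0.
have [K uK [K1 K2]] : exists2 K : A, K \is a GRing.unit &
    ev a b * e1 * K = K * e1 /\ ev a b * e2 * K = K * e2.
  have [an1|an1] := eqVneq a (-1).
    have b0 : b = 0.
      move: gn; rewrite an1 sqrrN expr1n => /eqP.
      by rewrite -subr_eq0 addrAC subrr add0r mulf_eq0 (negbTE st0) sqrf_eq0
        => /eqP.
    exists (ev 0 1).
      by apply: cl_ev_unit; rewrite expr0n add0r expr1n mulr1.
    by rewrite b0 an1 /cl_gen /cl_ev /= !cl_mk_mul; split; congr cl_mk; ring.
  exists (ev (1 + a) b).
    apply: cl_ev_unit.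
    (* Since [g] has norm 1, the norm of [1 + g] is [2 * (1 + a)]. *)
    have -> : (1 + a) ^+ 2 + s * t * b ^+ 2 =
      (a ^+ 2 + s * t * b ^+ 2) + 1 + 2 * a by ring.
    rewrite gn (_ : 1 + 1 + 2 * a = 2 * (a - (-1))); last by ring.
    by rewrite mulf_neq0 // subr_eq0.
  (* With g' the conjugate of [g], this is g (1 + g') = g + 1. *)
  have E : ev a b * ev (1 + a) (- b) = ev (1 + a) b.
    rewrite cl_ev_mul (_ : _ - _ = a ^+ 2 + s * t * b ^+ 2 + a); last by ring.
    by rewrite gn; congr cl_ev; ring.
  by split; rewrite -mulrA ?cl_ev_gen0 ?cl_ev_gen1 mulrA E.
have [eps1|eps1] : eps = 1 \/ eps = -1.
    by move/eqP: epsn; rewrite sqrf_eq1 => /orP[] /eqP; [left | right].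
  by exists K => //; rewrite eps1 scale1r.
(* The factor [e1] commutes with [e1] and anticommutes with [e2], which absorbs the sign
   [eps = -1]. *)
exists (K * e1); first by rewrite unitrMl // cl_gen0_unit.
rewrite !mulrA K1 K2 eps1 scaleN1r; split=> //.
have e21 : - (e2 * e1) = e1 * e2.
  rewrite -scaleN1r /cl_gen /= !cl_mk_mul cl_mk_scale; congr cl_mk; ring.
by rewrite -[K * e2 * e1]mulrA -[K * e1 * e2]mulrA -e21 mulrN.
Qed.

(** For E = [ev e f] of norm 1, [e1 * E] equals E^-1 e1, so with g = [ev a b] one gets E^2 g e1 E =
    E g e1, and [K] then turns g e1 K into K e1. The same holds for [e2]. *)
Lemma frame_conjugation (a b c d eps e f : F) (K : A) :
  K \is a GRing.unit ->
  ev a b * e1 * K = K * e1 -> eps *: (ev a b * e2 * K) = K * e2 ->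
  e ^+ 2 + s * t * f ^+ 2 = 1 -> ev e f * ev e f * ev a b = ev c d ->
  let T := ev e f * K in
  [/\ T \is a GRing.unit, e1 = T^-1 * (ev c d * e1) * T &
      e2 = T^-1 * (eps *: (ev c d * e2)) * T].
Proof.
move=> uK K1 K2 En gE T.
have EE : ev e f * ev e (- f) = 1 by rewrite cl_ev_conj En scale1r.
have uT : T \is a GRing.unit.
  by rewrite /T unitrMl // cl_ev_unit // En oner_eq0.
have P : ev c d * ev e (- f) = ev e f * ev a b.
  by rewrite -gE -mulrA [ev a b * _]cl_ev_comm mulrA -[ev e f * _ * _]mulrA EE
    mulr1.
split=> //; apply: (mulrI uT); rewrite !mulrA divrr // mul1r /T.
  rewrite -[ev c d * e1 * ev e f]mulrA cl_ev_gen0 [ev c d * _]mulrA P.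
  by rewrite -[LHS]mulrA -K1 !mulrA.
rewrite -!scalerAl -[ev c d * e2 * ev e f]mulrA cl_ev_gen1 [ev c d * _]mulrA P.
by rewrite -[LHS]mulrA -K2 -scalerAr !mulrA.
Qed.

End Frames.

Lemma sum_ord2 (Z : zmodType) (G : 'I_2 -> Z) : \sum_(a < 2) G a = G 0 + G 1.
Proof.
rewrite !big_ord_recl big_ord0 addr0; congr (_ + G _).
by apply: val_inj.
Qed.

Lemma cl_grade1_coord (F : fieldType) (p q : nat) (U : Cl F p q) :
  U \in cl_grade1 F p q -> U 0 0 = 0 /\ U 0 3 = 0.
Proof.
rewrite /cl_grade1 span_cons span_seq1 => /memv_addP[_ /vlineP[a ->]].
move=> [_ /vlineP[b ->]] ->.
by rewrite /cl_gen /= !cl_mk_scale cl_mk_add !cl_mk_coord !mulr0 addr0.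
Qed.

(** * Smooth fields of frames *)

Section FrameField.
Variables (R : realType) (k : base_field) (p q r : nat).
Local Notation F := (scalars R k).
Local Notation V := 'rV[R]_r.
Local Notation s := (eta F p q 0 0).
Local Notation t := (eta F p q 1 1).
Local Notation iota := (@sc_C R k).
Variable h : 'I_2 -> V -> Cl F p q.
Hypotheses (h_smooth : forall a, cl_smooth (h a))
  (h_grade1 : forall a x, h a x \in cl_grade1 F p q)
  (h_anticomm : forall a b x,
     h a x * h b x + h b x * h a x = (2 * eta F p q a b) *: 1).

Let y1 x := h 0 x 0 1.
Let y2 x := h 0 x 0 2.
Let z1 x := h 1 x 0 1.
Let z2 x := h 1 x 0 2.
Let eps x := y1 x * z2 x - y2 x * z1 x.

Lemma frame0E x : h 0 x = cl_mk p q 0 (y1 x) (y2 x) 0.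
Proof.
have [h0 h3] := cl_grade1_coord (h_grade1 0 x).
by rewrite [LHS]cl_mk_eta h0 h3.
Qed.

Lemma frame1E x : h 1 x = cl_mk p q 0 (z1 x) (z2 x) 0.
Proof.
have [h0 h3] := cl_grade1_coord (h_grade1 1 x).
by rewrite [LHS]cl_mk_eta h0 h3.
Qed.

Lemma two_neq0 : 2 != 0 :> F. Proof. by rewrite pnatr_eq0. Qed.

(** The coefficients of 1 in the three anticommutation relations are twice the hypotheses of
    [orthogonal_pair]. *)
Lemma frame_relations x : [/\ y1 x ^+ 2 + s * t * y2 x ^+ 2 = 1,
  z1 x = - (s * t * eps x * y2 x), z2 x = eps x * y1 x & eps x ^+ 2 = 1].
Proof.
apply: orthogonal_pair.
- have := congr1 (fun U : Cl F p q => U 0 0) (h_anticomm 0 0 x).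
  rewrite frame0E cl_oneE cl_mk_scale cl_mk_mul cl_mk_add !cl_mk_coord => H.
  apply: (mulfI two_neq0); rewrite -[RHS]mulr1 -[RHS]H; ring.
- have := congr1 (fun U : Cl F p q => U 0 0) (h_anticomm 1 1 x).
  rewrite frame1E cl_oneE cl_mk_scale cl_mk_mul cl_mk_add !cl_mk_coord => H.
  apply: (mulfI two_neq0); rewrite -[RHS]mulr1 -[RHS]H; ring.
- have := congr1 (fun U : Cl F p q => U 0 0) (h_anticomm 0 1 x).
  have -> : eta F p q 0 1 = 0 by rewrite !mxE.
  rewrite frame0E frame1E cl_oneE cl_mk_scale cl_mk_mul cl_mk_mul cl_mk_add
    !cl_mk_coord => H.
  apply: (mulfI two_neq0); rewrite mulr0 -[RHS](mul0r 1) -[X in _ = X *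
    1](mulr0 2) -[RHS]H; ring.
Qed.

Let D a i x (v : V) : R[i] :=
  \sum_(mu < r) (v 0 mu)%:C%C * iota (cl_partial mu (h a) x 0 i).

Lemma frame_cdiff a i x : cdiff x (fun y => iota (h a y 0 i)) (D a i x).
Proof. exact: cl_smooth_cdiff. Qed.

Lemma frame_axis a i x mu : D a i x (axis R mu) = iota (cl_partial mu (h a) x
  0 i).
Proof.
rewrite /D (bigD1 mu) //= big1 ?addr0 => [|nu numu]; rewrite !mxE eqxx /=.
  by rewrite eqxx mul1r.
by rewrite (negbTE numu) mul0r.
Qed.

(** Differentiating [eps ^+ 2 = 1] gives [2 * eps * de = 0], and [eps] does not vanish. *)
Lemma orientation_cst x : eps x = eps 0.
Proof.
apply: (@sc_C_inj R k).
apply: (cdiff0_ray (f := fun y => iota (eps y))) => a _.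
set y := a *: x.
pose de v := iota (y1 y) * D 1 2 y v + D 0 1 y v * iota (z2 y) -
  (iota (y2 y) * D 1 1 y v + D 0 2 y v * iota (z1 y)).
have c' : cdiff y (fun y => iota (eps y)) de.
  have := cdiffB (cdiffM (frame_cdiff 0 1 y) (frame_cdiff 1 2 y))
                 (cdiffM (frame_cdiff 0 2 y) (frame_cdiff 1 1 y)).
  by move/cdiff_ext; apply => // x'; rewrite /eps rmorphB !rmorphM.
apply: (cdiff_ext c') => // v.
have c1 : cdiff y (fun y => iota (eps y) * iota (eps y)) (fun=> 0).
  apply: (cdiff_ext (cdiff_cst y 1)) => // x'.
  by have [_ _ _ e2] := frame_relations x'; rewrite -rmorphM -expr2 e2 rmorph1.
have := cdiff_unique (cdiffM c' c') c1 v => /=.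
have e0 : iota (eps y) != 0.
  have [_ _ _ e2] := frame_relations y.
  rewrite fmorph_eq0; apply/eqP => e0; move: e2; rewrite e0 expr0n => /eqP.
  by rewrite eq_sym oner_eq0.
rewrite [de v * _]mulrC -mulr2n -mulrnAr => /eqP;
  rewrite mulf_eq0 (negbTE e0) /=.
by rewrite mulrn_eq0 => /eqP.
Qed.

Lemma frame_inv x : (h 0 x)^-1 = s *: h 0 x /\ (h 1 x)^-1 = t *: h 1 x.
Proof.
have inv (a : 'I_2) : (h a x)^-1 = eta F p q a a *: h a x.
  have hh : h a x * h a x = (eta F p q a a)%:A.
    have := h_anticomm a a x; rewrite -mulr2n -scaler_nat -scalerA.
    by move/(scalerI two_neq0).
  have ee := eta_sqr F p q a.
  have [||//] := @inv_unique _ (h a x) (eta F p q a a *: h a x).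
    by rewrite -scalerAr hh scalerA ee scale1r.
  by rewrite -scalerAl hh scalerA ee scale1r.
by split.
Qed.

Let P a mu x i : F := cl_partial mu (h a) x 0 i.

(** Uniqueness of the differential allows [frame_relations] to be differentiated with [eps] held
    constant; the last identity is half the derivative of the norm relation. *)
Lemma frame_partials mu x : [/\
  forall a, P a mu x 0 = 0 /\ P a mu x 3 = 0,
  P 1 mu x 1 = - (s * t * eps x * P 0 mu x 2),
  P 1 mu x 2 = eps x * P 0 mu x 1 &
  y1 x * P 0 mu x 1 + s * t * (y2 x * P 0 mu x 2) = 0].
Proof.
have U f df dg : cdiff x f df -> cdiff x f dg ->
  df (axis R mu) = dg (axis R mu).
  by move=> c1 c2; exact: cdiff_unique c1 c2 _.
have H0 a i : (forall y, h a y 0 i = 0) -> P a mu x i = 0.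
  move=> hz; apply: (@sc_C_inj R k); rewrite -[LHS]frame_axis rmorph0.
  apply: (U _ _ (fun=> 0) (frame_cdiff a i x)).
  by apply: (cdiff_ext (cdiff_cst x 0)) => // y; rewrite hz rmorph0.
split.
- by move=> a; split; apply: H0 => y; have [] := cl_grade1_coord (h_grade1 a y).
- apply: (@sc_C_inj R k); rewrite -[LHS]frame_axis.
  rewrite (U _ _ _ (frame_cdiff 1 1 x) (cdiff_ext
    (cdiffMl (iota (- (s * t * eps x))) (frame_cdiff 0 2 x)) _ (frefl _))).
    by rewrite frame_axis -rmorphM mulNr.
  move=> y; rewrite -rmorphM; congr (iota _).
  have [_ e _ _] := frame_relations y.
  by rewrite -/(z1 y) -/(y2 y) e (orientation_cst y) (orientation_cst x) mulNr.
- apply: (@sc_C_inj R k); rewrite -[LHS]frame_axis.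
  rewrite (U _ _ _ (frame_cdiff 1 2 x) (cdiff_ext
    (cdiffMl (iota (eps x)) (frame_cdiff 0 1 x)) _ (frefl _))).
    by rewrite frame_axis -rmorphM.
  move=> y; rewrite -rmorphM; congr (iota _).
  have [_ _ e _] := frame_relations y.
  by rewrite -/(z2 y) -/(y1 y) e (orientation_cst y) (orientation_cst x).
- apply: (@sc_C_inj R k); apply: (@mulfI _ 2); first by rewrite pnatr_eq0.
  rewrite rmorph0 mulr0.
  have c := cdiffD (cdiffM (frame_cdiff 0 1 x) (frame_cdiff 0 1 x))
    (cdiffMl (iota (s * t)) (cdiffM (frame_cdiff 0 2 x) (frame_cdiff 0 2 x))).
  have := U _ _ _ c (cdiff_ext (cdiff_cst x 1) _ (frefl _)).
  rewrite !frame_axis => <-.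
    by rewrite rmorphD !rmorphM; ring.
  move=> y; have [e _ _ _] := frame_relations y.
  by rewrite -!rmorphM -rmorphD -(rmorph1 iota) -e !expr2.
Qed.

(** The coefficient of [e12] in (1/2) (d_mu g) g^-1 for g = y1 - s y2 e12; having norm 1, g has its
    conjugate as inverse. *)
Definition rotation_rate mu x : F :=
  2^-1 * (y1 x * (- s * P 0 mu x 2) - (- s * y2 x) * P 0 mu x 1).

Lemma connection_ev mu x :
  4^-1 *: \sum_(a < 2) cl_partial mu (h a) x * (h a x)^-1 =
  cl_ev p q 0 (rotation_rate mu x).
Proof.
have [P0 E1 E2 E3] := frame_partials mu x.
have [i0 i1] := frame_inv x.
have [n1 w1 w2 e2] := frame_relations x.
have PE a : cl_partial mu (h a) x = cl_mk p q 0 (P a mu x 1) (P a mu x 2) 0.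
  by have [q0 q3] := P0 a; rewrite [LHS]cl_mk_eta -!/(P a mu x _) q0 q3.
rewrite sum_ord2.
rewrite i0 i1 !PE frame0E frame1E w1 w2 E1 E2 !cl_mk_scale !cl_mk_mul
  cl_mk_add cl_mk_scale.
rewrite /cl_ev /rotation_rate.
have s2 : s ^+ 2 = 1 by exact: eta_sqr.
have t2 : t ^+ 2 = 1 by exact: eta_sqr.
have sq1 (z : F) : z ^+ 2 = 1 -> z = 1 \/ z = -1.
  by move=> /eqP; rewrite sqrf_eq1 => /orP[] /eqP; [left | right].
have n4 : 4 = 2 * 2 :> F by rewrite -natrM.
have n2 := two_neq0.
congr cl_mk.
(* The scalar part is a multiple of the differentiated norm relation; the signs [s], [t] and [eps]
   are eliminated by cases. *)
- transitivity (2^-1 * (y1 x * P 0 mu x 1 + s * t * (y2 x * P 0 mu x 2)));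
  last by rewrite E3 mulr0.
  by rewrite n4; have [-> | ->] := sq1 _ s2; have [-> | ->] := sq1 _ t2;
    have [-> | ->] := sq1 _ e2; field.
- ring.
- ring.
- by rewrite n4; have [-> | ->] := sq1 _ s2; have [-> | ->] := sq1 _ t2;
    have [-> | ->] := sq1 _ e2; field.
Qed.

(* With [g = y1 + g2 e12], the frame is [h 0 = g e1] and [h 1 = eps g e2]. *)
Let g2 x : F := - s * y2 x.

Lemma frame_ev x : h 0 x = cl_ev p q (y1 x) (g2 x) * cl_gen F p q 0 /\
  h 1 x = eps x *: (cl_ev p q (y1 x) (g2 x) * cl_gen F p q 1).
Proof.
have [n1 w1 w2 e2] := frame_relations x.
have s2 := eta_sqr F p q 0.
rewrite frame0E frame1E /cl_gen /cl_ev /g2 /= !cl_mk_mul cl_mk_scale w1 w2.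
split; congr cl_mk; try by ring.
by transitivity (s * s * y2 x); [rewrite s2 mul1r | ring].
Qed.

Lemma frame_norm x : y1 x ^+ 2 + s * t * g2 x ^+ 2 = 1.
Proof.
have [n1 _ _ _] := frame_relations x; rewrite -n1 /g2.
have -> : s * t * (- s * y2 x) ^+ 2 = s * s * (s * t * y2 x ^+ 2) by ring.
by rewrite eta_sqr mul1r.
Qed.

(** Even elements are compared through the characters at [l] and [- l]. At [l] the equality is the
    defining property of the logarithm; at [- l] it is the inverse equality, by the norm
    condition. *)
Lemma rotation_angle : exists2 c : V -> F,
  forall x, cdiff x (fun y => iota (c y))
    (fun v => \sum_(mu < r) (v 0 mu)%:C%C * iota (rotation_rate mu x)) &
  forall x, exists e f, [/\ cl_exp (cl_ev p q 0 (c x)) = cl_ev p q e f,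
    e ^+ 2 + s * t * f ^+ 2 = 1 &
    cl_ev p q e f * cl_ev p q e f * cl_ev p q (y1 0) (g2 0) =
    cl_ev p q (y1 x) (g2 x)].
Proof.
(* [- (s * t)] is the square of [e12]; over the reals it may be -1, so the root is taken in
   [R[i]]. *)
pose l : R[i] := sqrtc (- iota (s * t)).
have l2 : l ^+ 2 = - iota (s * t) by rewrite sqr_sqrtc.
have l2' : (- l) ^+ 2 = - iota (s * t) by rewrite sqrrN.
have l0 : l != 0.
  have : l ^+ 2 * l ^+ 2 = 1.
    rewrite l2 mulrNN -rmorphM mulrACA !eta_sqr mulr1 rmorph1 //.
  by apply: contra_eq_neq => ->; rewrite expr0n /= mul0r eq_sym oner_eq0.
have n2 : 2 != 0 :> R[i] by rewrite pnatr_eq0.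
pose u x := cl_char iota l (cl_ev p q (y1 x) (g2 x)).
pose u' x := cl_char iota (- l) (cl_ev p q (y1 x) (g2 x)).
have uE x : u x = iota (y1 x) + l * iota (g2 x) by rewrite /u cl_char_ev.
have u'E x : u' x = iota (y1 x) + - l * iota (g2 x) by rewrite /u' cl_char_ev.
have char_norm a b : cl_char iota l (cl_ev p q a b) * cl_char iota (- l)
  (cl_ev p q a b)
    = iota (a ^+ 2 + s * t * b ^+ 2).
  rewrite !cl_char_ev rmorphD !(rmorphM, rmorphXn).
  have -> : iota s * iota t * iota b ^+ 2 = - l ^+ 2 * iota b ^+ 2.
    by rewrite l2 opprK rmorphM.
  by ring.
have uu' x : u x * u' x = 1 by rewrite char_norm frame_norm rmorph1.
have u0 x : u x != 0.
  by apply/eqP => e; have := uu' x; rewrite e mul0r => /eqP;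
    rewrite eq_sym oner_eq0.
pose dg2 x v := - iota s * D 0 2 x v.
have c_g2 x : cdiff x (fun y => iota (g2 y)) (dg2 x).
  apply: (cdiff_ext (cdiffMl (- iota s) (frame_cdiff 0 2 x))) => // y.
  by rewrite /g2 rmorphM rmorphN.
pose du x v := D 0 1 x v + l * dg2 x v.
have c_u x : cdiff x u (du x).
  by apply: (cdiff_ext (cdiffD (frame_cdiff 0 1 x) (cdiffMl l (c_g2 x)))) =>
    // y; rewrite uE.
have [L [L0 cL eL]] := log_lift c_u u0.
have rate x v : (2 * l)^-1 * (du x v / u x) =
    \sum_(mu < r) (v 0 mu)%:C%C * iota (rotation_rate mu x).
  have uV : (u x)^-1 = u' x.
    by apply: (mulfI (u0 x)); rewrite uu' mulfV.
  (* Half the differential of the constant [u * u']; this is the part of [du / u] that must vanish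
     for the rate to remain. *)
  have con : iota (y1 x) * D 0 1 x v - l ^+ 2 * iota (g2 x) * dg2 x v = 0.
    have c := cdiffB (cdiffM (frame_cdiff 0 1 x) (frame_cdiff 0 1 x))
      (cdiffMl (l ^+ 2) (cdiffM (c_g2 x) (c_g2 x))).
    have c1 := cdiff_ext c _ (frefl _).
    have H := cdiff_unique (c1 _ _) (cdiff_cst x 1) v.
    apply: (mulfI n2); rewrite mulr0 -[RHS]H; first by move=> /=;
      rewrite -/(y1 x); ring.
    move=> y; rewrite -[RHS](uu' y) uE u'E -/(y1 y).
    by ring.
  rewrite uV u'E /du.
  have -> : (2 * l)^-1 * ((D 0 1 x v + l * dg2 x v) * (iota (y1 x) + - l *
    iota (g2 x)))
    = 2^-1 * (iota (y1 x) * dg2 x v - iota (g2 x) * D 0 1 x v) +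
     (2 * l)^-1 * (iota (y1 x) * D 0 1 x v - l ^+ 2 * iota (g2 x) * dg2 x v).
    by field; rewrite l0.
  rewrite con mulr0 addr0 /dg2 /D !mulr_sumr -sumrB mulr_sumr.
  apply: eq_bigr => mu _; rewrite /rotation_rate -/(g2 x).
  rewrite !(rmorphM, rmorphB, rmorphN) fmorphV rmorph_nat /P; ring.
have cLl x : cdiff x (fun y => (2 * l)^-1 * L y)
    (fun v => \sum_(mu < r) (v 0 mu)%:C%C * iota (rotation_rate mu x)).
  by apply: (cdiff_ext (cdiffMl _ (cL x))) => // v; rewrite rate.
pose c x : F := sc_mk k (ReC ((2 * l)^-1 * L x)) (ImC ((2 * l)^-1 * L x)).
have cE x : iota (c x) = (2 * l)^-1 * L x.
  rewrite sc_C_mk; first by case: (_ * L x).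
  move=> kR.
  (* Over the reals the imaginary part of [L / (2 * l)] vanishes at 0, and its differential is zero
     because the rates are real; so [c] is well defined. *)
  have := cdiff0_ray (x := x) (f := fun y => (ImC ((2 * l)^-1 * L y))%:C%C).
  rewrite L0 mulr0 /= => H; apply: (@complexI R); rewrite H // => a _.
  have [_ c2] := cLl (a *: x); split; last exact: is_diff_cst.
  apply: (is_diff_ext c2) => // v; rewrite ImC_sum big1 // => mu _.
  by rewrite ImCM /= (sc_im_Reals _ kR) mulr0 mul0r addr0.
exists c => [x|x].
  by apply: (cdiff_ext (cLl x)) => // y; rewrite cE.
have [e [f [E H]]] := cl_exp_ev 0 (c x) l0 l2.
have Hl : cl_char iota l (cl_ev p q e f) = cexp (2^-1 * L x).
  rewrite H; last by left.
  congr cexp; rewrite cl_char_ev rmorph0 add0r.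
  transitivity (l * ((2 * l)^-1 * L x)); first by congr (_ * _); exact: cE.
  by field; rewrite l0.
have Hl' : cl_char iota (- l) (cl_ev p q e f) = cexp (- (2^-1 * L x)).
  rewrite H; last by right.
  congr cexp; rewrite cl_char_ev rmorph0 add0r.
  transitivity (- l * ((2 * l)^-1 * L x)); first by congr (_ * _); exact: cE.
  by field; rewrite l0.
have LL : 2^-1 * L x + 2^-1 * L x = L x by field.
exists e, f; split=> //.
  apply: (@sc_C_inj R k); rewrite -[LHS]char_norm Hl Hl' cexpN.
  by rewrite [RHS]rmorph1.
rewrite !cl_ev_mul.
apply: (cl_char_inj (iota := iota) l0 n2); rewrite -!cl_ev_mul.
  rewrite [cl_ev p q e f * _]cl_ev_mul cl_char_mul // -cl_ev_mul cl_char_mul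
    // Hl -cexpD LL.
  exact: eL.
rewrite [cl_ev p q e f * _]cl_ev_mul cl_char_mul // -cl_ev_mul cl_char_mul //
  Hl' -cexpD -opprD LL.
(* After multiplication by [u x], both sides become 1. *)
apply: (mulfI (u0 x)); rewrite -/(u' _) -/(u' _) uu' -eL.
by rewrite mulrACA cexpN mul1r uu'.
Qed.

End FrameField.

(** * The potential and the conjugating function *)

Theorem theorem6 (R : realType) (k : base_field) (p q : nat)
    (pq2 : (p + q = 2)%N) (r : nat) (r_ge1 : (1 <= r)%N)
    (h : 'I_2 -> 'rV[R]_r -> Cl (scalars R k) p q)
    (h_smooth : forall a, cl_smooth (h a))
    (h_grade1 : forall a x, h a x \in cl_grade1 (scalars R k) p q)
    (h_anticomm : forall a b x,
      h a x * h b x + h b x * h a x = (2 * eta (scalars R k) p q a b) *: 1) :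
  let C_ (mu : 'I_r) (x : 'rV[R]_r) : Cl (scalars R k) p q :=
    4^-1 *: \sum_(a < 2) cl_partial mu (h a) x * (h a x)^-1 in
  exists C : 'rV[R]_r -> Cl (scalars R k) p q,
    [/\ forall x, C x \in cl_grade2 (scalars R k) p q,
        forall x, cl_is_diff x C
          (fun dx => \sum_(mu < r) sc_mk k (dx 0 mu) 0 *: C_ mu x)
      & exists2 K : Cl (scalars R k) p q, K \is a GRing.unit &
          let T x := cl_exp (C x) * K in
          forall x, T x \is a GRing.unit /\
            forall a, cl_gen (scalars R k) p q a = (T x)^-1 * h a x * T x].
Proof.
move=> C_.
have [c dc ec] := rotation_angle h_smooth h_grade1 h_anticomm.
have [_ _ _ eps2] := frame_relations h_grade1 h_anticomm 0.
have gn := frame_norm h_grade1 h_anticomm 0.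
(* [K] is built at the origin, where it intertwines [h 0] and [h 1] with the standard generators. *)
have [K uK [K1 K2]] := frame_intertwiner (two_neq0 R k) gn eps2.
exists (fun x => cl_ev p q 0 (c x)); split.
- move=> x; have -> : cl_ev p q 0 (c x) = c x *: cl_e12 (scalars R k) p q.
    by rewrite cl_e12E cl_mk_scale mulr0 mulr1.
  by rewrite memvZ // memv_line.
- move=> x i.
  (* The two real statements of [cl_is_diff] are, by computation, those of [cdiff] for the
     coordinate embedded in [R[i]]. *)
  suff : cdiff x (fun y => sc_C (cl_ev p q 0 (c y) 0 i)) (fun dx =>
    sc_C ((\sum_(mu < r) sc_mk k (dx 0 mu) 0 *: C_ mu x) 0 i)) by [].
  have E v : sc_C ((\sum_(mu < r) sc_mk k (v 0 mu) 0 *: C_ mu x) 0 i) =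
    \sum_(mu < r) (v 0 mu)%:C%C * sc_C (cl_ev p q 0 (rotation_rate h mu x) 0 i).
    rewrite summxE rmorph_sum; apply: eq_bigr => mu _ /=.
    rewrite cl_scaleE rmorphM /C_ connection_ev //; congr (_ * _).
    exact: sc_C_mk.
  have [i3|i0] : i = 3 \/ forall b : scalars R k, cl_ev p q 0 b 0 i = 0.
      case: (i) => -[|[|[|[|//]]]] Hi; last by left; apply: val_inj.
      - by right => b; rewrite mxE.
      - by right => b; rewrite mxE.
      - by right => b; rewrite mxE.
    apply: (cdiff_ext (dc x)) => v; rewrite ?E i3; first by rewrite cl_mk3.
    by apply: eq_bigr => mu _; rewrite cl_mk3.
  apply: (cdiff_ext (cdiff_cst x 0)) => v; first by rewrite i0 rmorph0.
  by rewrite E big1 // => mu _; rewrite i0 rmorph0 mulr0.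
exists K => // T x.
have [e [f [E En gE]]] := ec x.
have [h0 h1] := frame_ev h_grade1 h_anticomm x.
(* The sign at [x] is the sign at the origin, for which [K] was chosen. *)
rewrite (orientation_cst h_smooth h_grade1 h_anticomm x) in h1.
have [uT T0 T1] := frame_conjugation uK K1 K2 En gE.
rewrite /T E; split => // a.
have [->|->] : a = 0 \/ a = 1.
    by case: a => -[|[|//]] Ha; [left | right]; apply: val_inj.
  by rewrite h0 -T0.
by rewrite h1 -T1.
Qed.
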